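(* Let $r \ge 4$. Then there exists a constant $\alpha_r > 0$ and $t_0=t_0(r)$ such that the following holds for every integer $t\ge t_0$: if $m = \binom{t}{r} - \binom{t-2}{r-2} + s$ where $s$ is an integer with $r \le s \le \alpha_r \binom{t-2}{r-2}$, then there exists an $r$-graph $G$ with $m$ edges such that \[ \lambda(G) > \lambda(\mathcal{C}(m,r)). \]
   Context: An $r$-graph is a finite family $G$ of $r$-element subsets of $\mathbb{N}=\{1,2,\dots\}$ (its edges). A weighting of $\mathbb{N}$ is a function $w:\mathbb{N}\to[0,\infty)$ with $\sum_{x}w(x)=1$; for a set $e$ put $w(e)=\prod_{x\in e}w(x)$ and $w(G)=\sum_{e\in G}w(e)$. The Lagrangian of $G$ is $\lambda(G)=\max\{w(G): w \text{ a weighting of } \mathbb{N}\}$. The colex order on $\mathbb{N}^{(r)}$ is given by $A<B$ iff $\sum_{i\in A}2^i<\sum_{i\in B}2^i$; $\mathcal{C}(m,r)$ denotes the first $m$ sets of $\mathbb{N}^{(r)}$ in colex order. *)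

(* Defs.v *)
From HB Require Import structures.
From mathcomp Require Import all_boot all_order all_algebra.
From mathcomp Require Import finmap.
From mathcomp Require Import all_classical all_reals all_analysis.
Set Implicit Arguments. Unset Strict Implicit. Unset Printing Implicit Defensive.
Import Order.TTheory GRing.Theory Num.Theory numFieldNormedType.Exports.

Local Open Scope fset_scope.

(* The vertex set N = {1,2,...} is represented by the positive naturals. *)
Definition is_rgraph (r : nat) (G : {fset {fset nat}}) : Prop :=
  forall e, e \in G -> #|` e| = r /\ (forall x, x \in e -> (0 < x)%N).

Definition range1 (n : nat) : {fset nat} := [fset i | i in iota 1 n].

(* colex key: A < B iff colexval A < colexval B *)
Definition colexval (A : {fset nat}) : nat := (\sum_(i <- A) 2 ^ i)%N.

(* number of r-subsets of N={1,2,...} strictly before A in colex order;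
   any such B satisfies B ⊆ {1,...,max A}. *)
Definition colex_rank (r : nat) (A : {fset nat}) : nat :=
  count (fun B : {fset nat} => (#|` B| == r) && (colexval B < colexval A))
        (fpowerset (range1 (\max_(i <- A) i))).

(* C(m,r): the first m sets of N^(r) in colex order; they all lie inside
   {1,...,m+r} since binomial(m+r-1, r) >= m. *)
Definition colex_family (m r : nat) : {fset {fset nat}} :=
  [fset A in fpowerset (range1 (m + r)) |
     (#|` A| == r) && (colex_rank r A < m)%N].

Local Open Scope ring_scope.
Local Open Scope classical_set_scope.

(* weightings of N = {1,2,...} : nonnegative, total mass 1 (w 0 is unused, fixed to 0) *)
Definition weighting (R : realType) (w : nat -> R) : Prop :=
  (forall x, 0 <= w x) /\ w 0%N = 0 /\
  (fun n : nat => \sum_(0 <= k < n) w k) @ \oo --> (1 : R).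

Definition wset (R : realType) (w : nat -> R) (e : {fset nat}) : R :=
  \prod_(x <- e) w x.

Definition wgraph (R : realType) (w : nat -> R) (G : {fset {fset nat}}) : R :=
  \sum_(e <- G) wset w e.

(* Lagrangian: max (here sup, which is attained) of w(G) over weightings *)
Definition lagrangian (R : realType) (G : {fset {fset nat}}) : R :=
  sup [set wgraph w G | w in [set w : nat -> R | weighting w]].

(* Main.v *)
(** Write [r = k + 4], [n = t - 2], and let [V] be the first [n] vertices and [p, q] the
    last two.  The sets of the colex family either do not contain both [p] and [q], or
    have the form [A :|: {p, q}] with [A] among the first [s] sets of size [k + 2] on
    [V]; replacing these by another family of [s] sets gives the competitors.  Give [p]
    and [q] weight [a], and perturb the uniform weight [u] on [V] by [d] with
    [\sum d = 0].  To second order the value becomes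
      [flat + a^2 u^(k+1) \sum_i deg_i d_i - c \sum_i d_i^2]
    with [c] independent of the family, so its maximum exceeds the flat value by a
    multiple of the variance of the degree sequence.  Hence it suffices to find a family
    of [s] sets whose sum of squared degrees beats that of the colex segment by a
    constant factor: a sunflower with kernel of size [k + 1] when [s] is bounded, and
    [s] sets meeting a small set of vertices otherwise.  The errors are relatively
    [O(1/n)] as long as [a = O(1/n)]; larger [a] lose against the uniform weighting of
    all [t] vertices, and very small [a] against that of [t - 1] vertices. *)

Require Import Defs.
From mathcomp Require Import all_boot all_order all_algebra reals.
From mathcomp Require Import finmap.
From mathcomp Require Import zify ring lra.
Set Implicit Arguments. Unset Strict Implicit. Unset Printing Implicit Defensive.
Import Order.TTheory GRing.Theory Num.Theory.
Local Open Scope ring_scope.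

(** * Elementary symmetric polynomials *)

(** The condition [s >= r] is where strictness starts. The sum of squared degrees is the sum of |A ∩
    B| over ordered pairs of members, and distinct sets of size [k + 2] meet in at most [k + 1]
    points, so a sunflower is extremal. The first [k + 3] colex sets are all the [(k + 2)]-subsets
    of a set of size [k + 3]; they also meet pairwise in [k + 1] points and tie with the sunflower.
    The next set breaks the tie. For bounded [s] the excess is an absolute 2 over a bounded total,
    hence a constant factor, as the relative errors require. The colex side is bounded by its raw
    sum of squared degrees, while the competitor only realises its variance; its squared-mean term
    is small enough to leave a factor [1 + eps]. [lagrangian] is a supremum, so a strict comparison
    weighting by weighting would not be enough: every regime must yield a gap that does not depend
    on the weighting. Only upper bounds are needed on the colex side, so an inclusion into
    [pair_graph] and at most [s] sets in the segment suffice. *)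

Section ElementarySymmetric.
Variables (R : realFieldType) (T : finType).
Implicit Types (j : nat) (H : {set {set T}}) (V A B J : {set T}) (x y d : T -> R).

Definition layer V j : {set {set T}} :=
  [set A : {set T} | A \subset V & #|A| == j].

Definition wsum H x : R := \sum_(A in H) \prod_(i in A) x i.

Definition elsym V j x : R := wsum (layer V j) x.

Lemma elsymE V j x :
  elsym V j x = \sum_(A : {set T} | (A \subset V) && (#|A| == j)) \prod_(i in A) x i.
Proof. by apply: eq_bigl => A; rewrite inE. Qed.

Lemma wsum_ge0 H x : (forall i, 0 <= x i) -> 0 <= wsum H x.
Proof. by move=> x0; apply: sumr_ge0 => A _; apply: prodr_ge0. Qed.

Lemma wsum_le H x y : (forall i, 0 <= x i <= y i) -> wsum H x <= wsum H y.
Proof. by move=> xy; apply: ler_sum => A _; apply: ler_prod. Qed.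

Lemma wsum_sub H H' x : (forall i, 0 <= x i) -> H \subset H' ->
  wsum H x <= wsum H' x.
Proof.
move=> x0 /subsetP s; rewrite /wsum [leRHS](bigID (fun A => A \in H)) /=.
rewrite [X in _ <= X + _](eq_bigl (fun A => A \in H)) ?lerDl; last first.
  by move=> A; rewrite andb_idl // => /s.
by apply: sumr_ge0 => A _; apply: prodr_ge0.
Qed.

Lemma elsym0 V x : elsym V 0 x = 1.
Proof.
rewrite elsymE (big_pred1 set0) ?big_set0 // => A.
by rewrite cards_eq0 andb_idl // => /eqP ->; rewrite sub0set.
Qed.

Lemma elsym_in V i j x : i \in V ->
  \sum_(A : {set T} | (A \subset V) && (#|A| == j.+1) && (i \in A))
     \prod_(l in A) x l = x i * elsym (V :\ i) j x.
Proof.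
move=> iV; rewrite elsymE mulr_sumr.
rewrite (reindex_onto (fun A => i |: A) (fun A => A :\ i)) /=; last first.
  by move=> A /andP[_ iA]; rewrite setD1K.
apply: eq_big => [A|A].
  rewrite setU11 andbT subUset sub1set iV /= subsetD1.
  have [iA|iA] := boolP (i \in A).
    rewrite (_ : _ == A = false) ?andbF //; apply/negbTE/eqP => /setP/(_ i).
    by rewrite !inE eqxx iA.
  by rewrite cardsU1 iA setU1K // eqxx !andbT.
case/andP=> _ /eqP eA.
have iA : i \notin A by rewrite -eA !inE eqxx.
by rewrite big_setU1.
Qed.

Lemma elsym_notin V i j x :
  \sum_(A : {set T} | (A \subset V) && (#|A| == j) && (i \notin A))
     \prod_(l in A) x l = elsym (V :\ i) j x.
Proof. by rewrite elsymE; apply: eq_bigl => A; rewrite subsetD1 andbAC. Qed.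

Lemma elsymS V i j x : i \in V ->
  elsym V j.+1 x = elsym (V :\ i) j.+1 x + x i * elsym (V :\ i) j x.
Proof.
move=> iV; rewrite {1}elsymE (bigID (fun A => i \in A)) /= elsym_in //.
by rewrite elsym_notin addrC.
Qed.

Lemma sum_elsym_in V j x :
  \sum_(i in V) x i * elsym (V :\ i) j x = j.+1%:R * elsym V j.+1 x.
Proof.
under eq_bigr => i iV do rewrite -elsym_in // big_mkcondr /=.
rewrite exchange_big elsymE mulr_sumr /=; apply: eq_bigr => A /andP[AV /eqP cA].
rewrite -big_mkcondr /= sumr_const -[LHS]mulr_natl; congr (_%:R * _).
by rewrite -cA; apply: eq_card => i; rewrite unfold_in /= andb_idl // => /(subsetP AV).
Qed.

Lemma sum_elsym_notin V j x :
  \sum_(i in V) elsym (V :\ i) j x = (#|V| - j)%:R * elsym V j x.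
Proof.
under eq_bigr => i iV do rewrite -elsym_notin big_mkcondr /=.
rewrite exchange_big elsymE mulr_sumr /=; apply: eq_bigr => A /andP[AV /eqP cA].
rewrite -big_mkcondr /= sumr_const -[LHS]mulr_natl; congr (_%:R * _).
rewrite -cA -[in RHS](setIidPr AV) -cardsD.
by apply: eq_card => i; rewrite inE unfold_in /= andbC.
Qed.

Lemma elsym1 V x : elsym V 1 x = \sum_(i in V) x i.
Proof.
have := sum_elsym_in V 0 x; rewrite mul1r => <-; apply: eq_bigr => i _.
by rewrite elsym0 mulr1.
Qed.

Lemma elsym2 V x :
  2 * elsym V 2 x = (\sum_(i in V) x i) ^+ 2 - \sum_(i in V) x i ^+ 2.
Proof.
have := sum_elsym_in V 1 x => <-; rewrite expr2 mulr_suml -sumrB; apply: eq_bigr => i iV.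
rewrite elsym1 (big_setD1 _ iV) /=; ring.
Qed.

Lemma card_layer V j : #|layer V j| = 'C(#|V|, j).
Proof. exact: cards_draws. Qed.

Lemma wsum_const H k c : (forall A, A \in H -> #|A| = k) ->
  wsum H (fun=> c) = #|H|%:R * c ^+ k.
Proof.
move=> Hk; rewrite /wsum (eq_bigr (fun=> c ^+ k)).
  by rewrite sumr_const mulr_natl.
by move=> A AH; rewrite prodr_const Hk.
Qed.

Lemma elsym_const V j c : elsym V j (fun=> c) = 'C(#|V|, j)%:R * c ^+ j.
Proof.
by rewrite /elsym (@wsum_const _ j) ?card_layer // => A; rewrite inE => /andP[_ /eqP].
Qed.

Lemma eq_wsum H V x y : (forall A, A \in H -> A \subset V) ->
  (forall i, i \in V -> x i = y i) -> wsum H x = wsum H y.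
Proof.
move=> HV xy; apply: eq_bigr => A /HV/subsetP AV.
by apply: eq_bigr => i /AV /xy.
Qed.

Lemma eq_elsym V j x y : (forall i, i \in V -> x i = y i) ->
  elsym V j x = elsym V j y.
Proof. by apply: eq_wsum => A; rewrite inE => /andP[]. Qed.

Lemma elsym_ge0 V j x : (forall i, 0 <= x i) -> 0 <= elsym V j x.
Proof. exact: wsum_ge0. Qed.

Lemma elsymS_le V j x : (forall i, 0 <= x i) ->
  elsym V j.+1 x <= (\sum_(i in V) x i) * elsym V j x.
Proof.
move=> x0; apply: (@le_trans _ _ (j.+1%:R * elsym V j.+1 x)).
  by rewrite ler_peMl ?elsym_ge0 // ler1n.
rewrite -sum_elsym_in mulr_suml; apply: ler_sum => i iV.
rewrite ler_wpM2l //; apply: wsum_sub => //; apply/subsetP => A.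
by rewrite !inE subsetD1 -andbA => /and3P[-> _ ->].
Qed.

Lemma elsym_le_expr V j x : (forall i, 0 <= x i) ->
  elsym V j x <= (\sum_(i in V) x i) ^+ j.
Proof.
move=> x0; elim: j => [|j IH]; first by rewrite elsym0 expr0.
apply: le_trans (elsymS_le _ _ x0) _; rewrite exprS ler_wpM2l //.
by apply: sumr_ge0.
Qed.

Lemma chebyshev_identity V x y :
  \sum_(i in V) \sum_(l in V) (x i - x l) * (y i - y l) =
  2 * (#|V|%:R * (\sum_(i in V) x i * y i) -
       (\sum_(i in V) x i) * (\sum_(i in V) y i)).
Proof.
rewrite (eq_bigr (fun i => x i * y i * #|V|%:R + \sum_(l in V) x l * y l
   - x i * (\sum_(l in V) y l) - (\sum_(l in V) x l) * y i)); last first.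
  move=> i _ /=; rewrite mulr_sumr mulr_suml mulr_natr -sumr_const -big_split /=.
  rewrite -!sumrB; apply: eq_bigr => l _; ring.
rewrite !sumrB big_split /= -!mulr_suml -mulr_sumr sumr_const -mulr_natr; ring.
Qed.

(* Chebyshev's sum inequality: [x i] and [elsym (V :\ i) j x] are oppositely ordered. *)
Lemma elsym_chebyshev V j x : (forall i, 0 <= x i) ->
  #|V|%:R * (j.+1%:R * elsym V j.+1 x) <=
  (\sum_(i in V) x i) * ((#|V| - j)%:R * elsym V j x).
Proof.
move=> x0; rewrite -sum_elsym_in -sum_elsym_notin -subr_le0.
rewrite -(@pmulr_rle0 _ 2) ?ltr0n //.
rewrite -(chebyshev_identity V x (fun i => elsym (V :\ i) j x)).
apply: sumr_le0 => i iV; apply: sumr_le0 => l lV.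
have [->|il] := eqVneq i l; first by rewrite !subrr mul0r.
case: j => [|j]; first by rewrite !elsym0 subrr mulr0.
rewrite (@elsymS (V :\ i) l) ?(@elsymS (V :\ l) i) ?inE ?lV ?iV ?il 1?eq_sym ?il //.
have -> : V :\ l :\ i = V :\ i :\ l by rewrite !setDDl finset.setUC.
have := @elsym_ge0 (V :\ i :\ l) j x x0; set e1 := elsym _ j x => e10.
rewrite (_ : _ * _ = - ((x i - x l) ^+ 2 * e1)); last by ring.
by rewrite oppr_le0 mulr_ge0 // sqr_ge0.
Qed.

(** Iterates [elsym_chebyshev]: raising [j] by one costs a factor [u (n - j) / (j + 1)], which is
    also the growth of the right-hand side. *)
Lemma elsym_maclaurin V j x u : (forall i, 0 <= x i) -> (0 < #|V|)%N ->
  \sum_(i in V) x i = #|V|%:R * u -> 0 <= u ->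
  elsym V j x <= 'C(#|V|, j)%:R * u ^+ j.
Proof.
move=> x0 V0 sx u0; elim: j => [|j IH]; first by rewrite elsym0 bin0 mul1r.
have := elsym_chebyshev V j x0; rewrite sx -mulrA ler_pM2l ?ltr0n // => h.
rewrite -(@ler_pM2l _ j.+1%:R) ?ltr0n //; apply: le_trans h _.
rewrite [leRHS]mulrA -natrM mul_bin_left natrM exprS.
rewrite (_ : _ * (u * _) = u * ((#|V| - j)%:R * ('C(#|V|, j)%:R * u ^+ j))); last by ring.
by rewrite ler_wpM2l // ler_wpM2l // ler0n.
Qed.

(** The Chebyshev chain again, but stopped at degree 2 instead of 0, because [elsym V 2] still
    records the distance from uniform exactly ([elsym2_sqdist]). *)
Lemma elsym_le_elsym2 V j x u : (forall i, 0 <= x i) -> (0 < #|V|)%N ->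
  \sum_(i in V) x i = #|V|%:R * u -> 0 <= u ->
  j.+2%:R * j.+1%:R * elsym V j.+2 x <=
  2 * ('C(#|V| - 2, j)%:R * u ^+ j * elsym V 2 x).
Proof.
move=> x0 V0 sx u0; elim: j => [|j IH]; first by rewrite bin0 !mul1r mulr1.
have := elsym_chebyshev V j.+2 x0; rewrite sx -mulrA ler_pM2l ?ltr0n // => h.
rewrite -(@ler_pM2l _ j.+1%:R) ?ltr0n //.
rewrite [leLHS](_ : _ =
  j.+2%:R * j.+1%:R * (j.+3%:R * elsym V j.+3 x)); last by ring.
apply: le_trans (ler_wpM2l _ h) _; first by rewrite -natrM ler0n.
have e : j.+1%:R * 'C(#|V| - 2, j.+1)%:R = (#|V| - j.+2)%:R * 'C(#|V| - 2, j)%:R :> R.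
  by rewrite -!natrM mul_bin_left subnAC -subnDA addn2.
rewrite [leRHS](_ : _ = u * (2 * ((j.+1%:R * 'C(#|V| - 2, j.+1)%:R) * u ^+ j * elsym V 2 x)));
  last by rewrite exprS; ring.
rewrite e [leRHS](_ : _ = u * ((#|V| - j.+2)%:R * (2 * ('C(#|V| - 2, j)%:R * u ^+ j * elsym V 2 x)))); last by ring.
rewrite [leLHS](_ : _ = u * ((#|V| - j.+2)%:R * (j.+2%:R * j.+1%:R * elsym V j.+2 x))); last by ring.
by rewrite ler_wpM2l // ler_wpM2l // ler0n.
Qed.

Definition sqdist V u x : R := \sum_(i in V) (x i - u) ^+ 2.

Lemma sqdist_ge0 V u x : 0 <= sqdist V u x.
Proof. by apply: sumr_ge0 => i _; apply: sqr_ge0. Qed.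

Lemma elsym2_sqdist V x u : \sum_(i in V) x i = #|V|%:R * u ->
  2 * elsym V 2 x = #|V|%:R * (#|V|%:R - 1) * u ^+ 2 - sqdist V u x.
Proof.
move=> sx; rewrite elsym2 sx.
have -> : sqdist V u x = \sum_(i in V) x i ^+ 2 - 2 * u * (\sum_(i in V) x i) + #|V|%:R * u ^+ 2.
  have -> : #|V|%:R * u ^+ 2 = \sum_(i in V) u ^+ 2 by rewrite sumr_const mulr_natl.
  rewrite mulr_sumr -sumrB -big_split /=.
  apply: eq_bigr => i _; ring.
rewrite sx; ring.
Qed.

Lemma binS2 n j : (j.+2 * j.+1 * 'C(n, j.+2) = n * n.-1 * 'C(n - 2, j))%N.
Proof.
by rewrite subn2 -[RHS]mulnA mul_bin_diag mulnCA mul_bin_diag mulnA [(_ * j.+2)%N]mulnC.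
Qed.

(** A stability version of Maclaurin's inequality, valid for every nonnegative [x] and not only near
    uniform. It serves in the crude global bound and in the regimes of large and of very small
    [a]. *)
Lemma elsym_deficit V j x u : (forall i, 0 <= x i) -> (0 < #|V|)%N ->
  \sum_(i in V) x i = #|V|%:R * u -> 0 <= u ->
  elsym V j.+2 x <= 'C(#|V|, j.+2)%:R * u ^+ j.+2 -
    'C(#|V| - 2, j)%:R * u ^+ j / (j.+2 * j.+1)%:R * sqdist V u x.
Proof.
move=> x0 V0 sx u0; have jj : 0 < (j.+2 * j.+1)%:R :> R by rewrite ltr0n.
rewrite -(ler_pM2l jj) natrM; apply: le_trans (elsym_le_elsym2 j x0 V0 sx u0) _.
rewrite mulrCA (elsym2_sqdist sx) -natrM.
have e : (j.+2 * j.+1)%:R * 'C(#|V|, j.+2)%:R =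
    #|V|%:R * (#|V|%:R - 1) * 'C(#|V| - 2, j)%:R :> R.
  by rewrite -natrM binS2 -subn1 !natrM natrB.
rewrite le_eqVlt; apply/orP; left; apply/eqP.
rewrite [RHS]mulrBr [X in _ = X - _]mulrA e !exprS.
move: jj; set b := (_ * _)%:R => jj.
have : b != 0 by rewrite gt_eqF.
by move: (b) => c c0; field.
Qed.

Lemma sqdist_ge V u x i : i \in V -> (x i - u) ^+ 2 <= sqdist V u x.
Proof.
move=> iV; rewrite /sqdist (big_setD1 _ iV) /= lerDl.
by apply: sumr_ge0 => l _; apply: sqr_ge0.
Qed.

End ElementarySymmetric.

(** * Expansion around a constant weighting *)

Section Expansion.
Variables (R : realFieldType) (T : finType).
Implicit Types (j k : nat) (H : {set {set T}}) (V A B J : {set T}) (x y d : T -> R).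

(* Newton's recursion [j E_j = - \sum_i d_i^2 E_(j-2)(V :\ i)], valid since [\sum d = 0]. *)
Lemma elsym_centered_bound V j d rho : 0 <= rho ->
  \sum_(i in V) d i = 0 -> \sum_(i in V) d i ^+ 2 = rho ^+ 2 ->
  `|elsym V j d| <= 2 ^+ j * rho ^+ j /\
  (forall i, i \in V -> `|elsym (V :\ i) j d| <= 2 ^+ j * rho ^+ j).
Proof.
move=> rho0 sd0 sd2.
have drho i : i \in V -> `|d i| <= rho.
  move=> iV; rewrite -(@ler_pXn2r _ 2) ?nnegrE // real_normK ?num_real // -sd2.
  by rewrite (big_setD1 _ iV) /= lerDl; apply: sumr_ge0 => l _; apply: sqr_ge0.
have step m : (m = 0%N \/ exists2 m', m = m'.+1 & forall i, i \in V -> `|elsym (V :\ i) m' d| <= 2 ^+ m' * rho ^+ m') ->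
  `|elsym V m.+1 d| <= 2 ^+ m * rho ^+ m.+1.
  move=> hm; have := sum_elsym_in V m d.
  case: hm => [->|[m' -> IH]].
    by rewrite mul1r => <-; under eq_bigr do rewrite elsym0 mulr1;
       rewrite sd0 normr0 mul1r.
  move=> h; have {}h : m'.+2%:R * elsym V m'.+2 d = - \sum_(i in V) d i ^+ 2 * elsym (V :\ i) m' d.
    rewrite -h; transitivity (\sum_(i in V) (d i * elsym V m'.+1 d - d i ^+ 2 * elsym (V :\ i) m' d)).
      apply: eq_bigr => i iV; rewrite (elsymS _ _ iV); ring.
    by rewrite sumrB -mulr_suml sd0 mul0r sub0r.
  have : `|m'.+2%:R * elsym V m'.+2 d| <= 2 ^+ m' * rho ^+ m'.+2.
    rewrite h normrN; apply: le_trans (ler_norm_sum _ _ _) _.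
    apply: (@le_trans _ _ (\sum_(i in V) d i ^+ 2 * (2 ^+ m' * rho ^+ m'))).
      apply: ler_sum => i iV; rewrite normrM ger0_norm ?sqr_ge0 //.
      by rewrite ler_wpM2l ?sqr_ge0 // IH.
    by rewrite -mulr_suml sd2 mulrCA -exprD.
  rewrite normrM normr_nat => h2.
  apply: le_trans (le_trans h2 _).
    by rewrite ler_peMl // ler1n.
  by rewrite ler_wpM2r ?exprn_ge0 // ler_weXn2l ?ler1n.
have [n le_jn] := ubnP j; elim: n => // n IHn in j le_jn *.
case: j => [|j] in le_jn *.
  by split=> [|i _]; rewrite elsym0 normr1 !expr0 mul1r.
(* A factor 2 better than claimed. It pays for the passage to [V :\ i], where [d] is no longer
   centred and the extra term [d i * elsym (V :\ i) j d] appears. *)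
have hV : `|elsym V j.+1 d| <= 2 ^+ j * rho ^+ j.+1.
  apply: step; case: j => [|j] in le_jn *; [by left|right; exists j => //].
  by case: (IHn j); first lia.
have p0 : 0 <= 2 ^+ j * rho ^+ j.+1 by rewrite mulr_ge0 ?exprn_ge0.
split; first by apply: le_trans hV _; rewrite [2 ^+ j.+1]exprS -mulrA ler_peMl //; lra.
move=> i iV; have -> : elsym (V :\ i) j.+1 d = elsym V j.+1 d - d i * elsym (V :\ i) j d.
  by rewrite (elsymS _ _ iV); ring.
apply: le_trans (ler_normB _ _) _.
rewrite [2 ^+ j.+1]exprS -mulrA mulrDl mul1r lerD // normrM exprS mulrCA.
by apply: ler_pM => //; [apply: drho | case: (IHn j); first lia; move=> _; apply].
Qed.

Definition codeg H J : nat := #|[set A in H | J \subset A]|.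

(** [wsum H] is multilinear, so its Taylor expansion at a constant is finite and exact; the
    codegrees are its coefficients. *)
Lemma wsum_shift H k u d : (forall A, A \in H -> #|A| = k) ->
  wsum H (fun i => u + d i) =
  \sum_(j < k.+1) u ^+ (k - j) *
    \sum_(J : {set T} | #|J| == j) (codeg H J)%:R * \prod_(i in J) d i.
Proof.
move=> Hk.
have expand A : A \in H -> \prod_(i in A) (u + d i) =
    \sum_(J : {set T} | J \subset A) u ^+ (k - #|J|) * \prod_(i in J) d i.
  move=> AH; rewrite big_mkcond /=.
  (* Indices outside [A] contribute [0 + 1], so distributing over all [J] kills every [J] not
     contained in [A]. *)
  rewrite (eq_bigr (fun i => (if i \in A then d i else 0) +
    (if i \in A then u else 1))); last first.
    by move=> i _; case: ifP; rewrite ?add0r 1?addrC.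
  rewrite bigA_distr (bigID (fun J => J \subset A)) /= [X in _ + X]big1 ?addr0.
    apply: eq_big => [J|J JA]; first by [].
    rewrite (bigID (fun i => i \in J)) /= mulrC; congr (_ * _).
      transitivity (\prod_(i in A :\: J) u).
        rewrite [RHS]big_mkcond [LHS]big_mkcond /=; apply: eq_bigr => i _.
        by rewrite inE; case: (i \in J); case: (i \in A).
      by rewrite prodr_const cardsD (setIidPr JA) Hk.
    by apply: eq_bigr => i iJ; rewrite iJ (subsetP JA).
  move=> J /subsetPn[i iJ iA].
  by rewrite (bigD1 i) //= iJ (negPf iA) mul0r.
rewrite /wsum (eq_bigr _ expand).
under eq_bigr do rewrite big_mkcond /=.
rewrite exchange_big /=.
transitivity (\sum_(J : {set T} | (#|J| < k.+1)%N) u ^+ (k - #|J|) * ((codeg H J)%:R * \prod_(i in J) d i)).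
  rewrite [LHS](bigID (fun J : {set T} => (#|J| < k.+1)%N)) /= addrC big1 ?add0r.
    apply: eq_bigr => J _; rewrite -big_mkcondr /= sumr_const -[LHS]mulr_natl mulrCA.
    congr (_ * (_%:R * _)); apply: eq_card => A.
    by rewrite inE.
  move=> J; rewrite -leqNgt => kJ; apply: big1 => A AH.
  by case: ifP => // /subset_leq_card; rewrite (Hk _ AH) leqNgt kJ.
under [RHS]eq_bigr do rewrite mulr_sumr.
rewrite (exchange_big_dep (fun J : {set T} => (#|J| < k.+1)%N)) /=; last first.
  by move=> j J _ /eqP ->.
apply: eq_bigr => J kJ; by rewrite (big_pred1 (Ordinal kJ)).
Qed.

Lemma codeg_le V H k J : (forall A, A \in H -> A \subset V) ->
  (forall A, A \in H -> #|A| = k) -> (codeg H J <= 'C(#|V| - #|J|, k - #|J|))%N.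
Proof.
move=> HV Hk; have [JV|nJV] := boolP (J \subset V); last first.
  rewrite /codeg (_ : [set _ in _ | _] = set0) ?cards0 //; apply/setP => A.
  rewrite !inE; apply/negbTE/negP => /andP[/HV AV JA].
  by move/negP: nJV; apply; apply: subset_trans JA AV.
have -> : (#|V| - #|J|)%N = #|V :\: J| by rewrite cardsD (setIidPr JV).
rewrite -cards_draws /codeg.
rewrite -(@card_in_imset _ _ (fun A => A :\: J) [set A in H | J \subset A]).
  apply: subset_leq_card; apply/subsetP => B /imsetP[A].
  rewrite !inE => /andP[AH JA] ->; rewrite setSD ?HV //=.
  by rewrite cardsD (setIidPr JA) Hk.
move=> A B; rewrite !inE => /andP[_ JA] /andP[_ JB] e.
by rewrite -(setID A J) -(setID B J) e (setIidPr JA) (setIidPr JB).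
Qed.

Lemma codeg_layer V k J : J \subset V -> (#|J| <= k)%N ->
  codeg (layer V k) J = 'C(#|V| - #|J|, k - #|J|).
Proof.
move=> JV Jk; have -> : (#|V| - #|J|)%N = #|V :\: J| by rewrite cardsD (setIidPr JV).
rewrite -cards_draws /codeg.
rewrite -(@card_in_imset _ _ (fun A => A :|: J) [set A : {set T} | A \subset V :\: J & #|A| == _]%N).
  apply: eq_card => A; rewrite !inE; apply/andP/imsetP => [[/andP[AV /eqP cA] JA]|[B]].
    exists (A :\: J); last by rewrite -{1}(setID A J) (setIidPr JA) setUC.
    by rewrite inE setSD // cardsD (setIidPr JA) cA eqxx.
  rewrite inE subsetD => /andP[/andP[BV dBJ] /eqP cB] ->.
  rewrite subUset BV JV subsetUr; split=> //.
  by rewrite cardsU (disjoint_setI0 dBJ) cards0 subn0 cB subnK /= ?eqxx.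
move=> A B; rewrite !inE !subsetD => /andP[/andP[_ dA] _] /andP[/andP[_ dB] _] e.
have r (C : {set T}) : [disjoint C & J] -> (C :|: J) :\: J = C.
  by move=> dC; rewrite setDUl setDv setU0; apply/setDidPl.
by rewrite -(r _ dA) e r.
Qed.

End Expansion.

Lemma bin_le_expn n m : ('C(n, m) <= n ^ m)%N.
Proof.
elim: m => [|m IH]; first by rewrite bin0.
apply: (@leq_trans (m.+1 * 'C(n, m.+1))); first by rewrite leq_pmull.
by rewrite mul_bin_left expnS leq_mul // leq_subr.
Qed.

Lemma expn_le_bin n m : ((n - m) ^ m <= m`! * 'C(n, m))%N.
Proof.
elim: m => [|m IH]; first by rewrite bin0.
rewrite factS [(m.+1 * _)%N]mulnC -mulnA mul_bin_left mulnCA expnS leq_mul //.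
  by rewrite leq_sub2l.
apply: leq_trans IH; case: m => // m; rewrite leq_exp2r //; lia.
Qed.

Section ShiftEstimates.
Variables (R : realFieldType) (T : finType).
Implicit Types (j k : nat) (H : {set {set T}}) (V A B J : {set T}) (x y d : T -> R).

(** Since the total weight is at most 1, all binomial coefficients of the expansions are absorbed,
    which keeps the error constants independent of [n]. *)
Lemma bin_expr_le1 n m j (u : R) : (m <= n)%N -> 0 <= u -> n%:R * u <= 1 ->
  'C(m, j)%:R * u ^+ j <= 1.
Proof.
move=> mn u0 nu; apply: (@le_trans _ _ ((n%:R * u) ^+ j)).
  rewrite exprMn ler_wpM2r ?exprn_ge0 // -natrX ler_nat.
  by apply: leq_trans (bin_le_expn _ _) _; case: j => // j; rewrite leq_exp2r.
by rewrite exprn_ile1 // mulr_ge0.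
Qed.

(** Cauchy-Schwarz, read off from [chebyshev_identity] with both sequences equal to [|d|]. *)
Lemma sum_norm_sqr V d :
  (\sum_(i in V) `|d i|) ^+ 2 <= #|V|%:R * \sum_(i in V) d i ^+ 2.
Proof.
have := chebyshev_identity V (fun i => `|d i|) (fun i => `|d i|).
set L := LHS; have : 0 <= L.
  by apply: sumr_ge0 => i _; apply: sumr_ge0 => l _; rewrite -expr2 sqr_ge0.
move=> L0 e; rewrite -subr_ge0 -(@pmulr_rge0 _ 2) //; move: L0; rewrite e expr2.
congr (0 <= 2 * (_ * _ - _)); apply: eq_bigr => i _.
by rewrite -expr2 real_normK ?num_real.
Qed.

Lemma elsym_shift V m u d :
  elsym V m (fun i => u + d i) =
  \sum_(j < m.+1) u ^+ (m - j) * ('C(#|V| - j, m - j)%:R * elsym V j d).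
Proof.
have Hm A : A \in layer V m -> #|A| = m by rewrite inE => /andP[_ /eqP].
rewrite /elsym (wsum_shift _ _ Hm); apply: eq_bigr => j _; congr (_ * _).
rewrite -/(elsym V j d) elsymE mulr_sumr [LHS](bigID (fun J => J \subset V)) /=.
rewrite addrC big1 ?add0r.
  apply: eq_big => [J|J /andP[/eqP cJ JV]]; first by rewrite andbC.
  by rewrite codeg_layer ?cJ // -ltnS.
move=> J /andP[_ nJV]; rewrite /codeg (_ : [set _ in _ | _] = set0) ?cards0 ?mul0r //.
apply/setP => A; rewrite !inE; apply/negbTE/negP => /andP[/andP[AV _] JA].
by move/negP: nJV; apply; apply: subset_trans JA AV.
Qed.

(** The linear term vanishes and the quadratic one is exact, as [elsym V 2 d = - rho^2 / 2] for
    centred [d]. The remaining [m] terms are bounded by [elsym_centered_bound]. *)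
Lemma elsym_shift_bound V m u d rho : 0 <= u -> #|V|%:R * u <= 1 ->
  0 <= rho <= 1 -> \sum_(i in V) d i = 0 -> \sum_(i in V) d i ^+ 2 = rho ^+ 2 ->
  `|elsym V m.+2 (fun i => u + d i) -
    ('C(#|V|, m.+2)%:R * u ^+ m.+2 - 'C(#|V| - 2, m)%:R * u ^+ m * rho ^+ 2 / 2)|
  <= m%:R * 2 ^+ m.+2 * rho ^+ 3.
Proof.
move=> u0 nu /andP[rho0 rho1] sd0 sd2; rewrite elsym_shift.
rewrite !big_ord_recl /= /bump /= !subn0 elsym0 !mulr1 elsym1 sd0 !mulr0 add0r.
have e2 : elsym V 2 d = - (rho ^+ 2 / 2).
  have := elsym2 V d; rewrite sd0 sd2; lra.
rewrite add1n add1n e2 (_ : (m.+2 - 2)%N = m); last by lia.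
set S := \sum_(i < m) _.
rewrite (_ : _ - _ = S); last by ring.
apply: le_trans (ler_norm_sum _ _ _) _.
rewrite -mulrA mulr_natl -[X in _ *+ X]card_ord -sumr_const; apply: ler_sum => i _.
rewrite !add1n mulrA normrM ger0_norm; last by rewrite mulr_ge0 ?exprn_ge0.
rewrite -[leRHS]mul1r; apply: ler_pM => //; first by rewrite mulr_ge0 ?exprn_ge0.
  by rewrite mulrC; apply: (@bin_expr_le1 #|V|) => //; apply: leq_subr.
have [h _] := elsym_centered_bound i.+3 rho0 sd0 sd2.
apply: le_trans h _; apply: ler_pM; rewrite ?exprn_ge0 //.
  by rewrite ler_weXn2l ?ler1n // !ltnS.
by rewrite ler_wiXn2l.
Qed.

Definition deg H i : nat := codeg H [set i].

(** An arbitrary [H] allows no cancellation, so the terms of degree at least 2 are bounded through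
    the l1 norm of [d]. This costs a factor [n], which is affordable because [wsum H] is later
    multiplied by [a^2], of order [1/n^2]. *)
Lemma wsum_shift_bound H V k u d : 0 <= u -> #|V|%:R * u <= 1 ->
  (forall A, A \in H -> A \subset V) -> (forall A, A \in H -> #|A| = k.+2) ->
  \sum_(i in V) `|d i| <= 2 ->
  `|wsum H (fun i => u + d i) -
    (#|H|%:R * u ^+ k.+2 + u ^+ k.+1 * \sum_(i in V) (deg H i)%:R * d i)|
  <= k.+1%:R * 2 ^+ k * (#|V|%:R * \sum_(i in V) d i ^+ 2).
Proof.
move=> u0 nu HV Hk sd; rewrite (wsum_shift _ _ Hk) big_ord_recl big_ord_recl /= /bump /= !subn0.
have -> : \sum_(J : {set T} | #|J| == 0%N) (codeg H J)%:R * \prod_(i in J) d i = #|H|%:R.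
  rewrite (big_pred1 set0) => [|J]; last by rewrite cards_eq0.
  rewrite big_set0 mulr1; congr (_%:R); apply: eq_card => A.
  by rewrite inE sub0set andbT.
have -> : \sum_(J : {set T} | #|J| == 1%N) (codeg H J)%:R * \prod_(i in J) d i =
  \sum_(i in V) (deg H i)%:R * d i.
  rewrite (eq_bigl (fun J => J \in [set [set i] | i in [set: T]])); last first.
    move=> J; apply/cards1P/imsetP => [[i ->]|[i _ ->]]; exists i => //.
  rewrite big_imset /=; last by move=> i l _ _ /set1_inj.
  rewrite [RHS]big_mkcond; apply: eq_big => [i|i _]; first by rewrite inE.
  rewrite big_set1 -/(deg H i); case: ifP => // iV.
  rewrite /deg /codeg (_ : [set _ in _ | _] = set0) ?cards0 ?mul0r //.
  apply/setP => A; rewrite !inE sub1set; apply/negbTE/negP => /andP[/HV/subsetP h].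
  by move/h; rewrite iV.
rewrite (_ : (k.+2 - (1 + 0))%N = k.+1); last by lia.
set S := \sum_(i < k.+1) _.
rewrite (_ : _ - _ = S); last by ring.
apply: le_trans (ler_norm_sum _ _ _) _.
rewrite -mulrA mulr_natl -[X in _ *+ X]card_ord -sumr_const; apply: ler_sum => i _.
rewrite !add1n normrM ger0_norm ?exprn_ge0 //.
set j := i.+2; apply: (@le_trans _ _ (elsym V j (fun i => `|d i|))).
  apply: le_trans (ler_wpM2l _ (ler_norm_sum _ _ _)) _; first by rewrite exprn_ge0.
  rewrite elsymE mulr_sumr [leLHS](bigID (fun J => J \subset V)) /=.
  rewrite addrC big1 ?add0r.
    rewrite (eq_bigl (fun J : {set T} => (J \subset V) && (#|J| == j))); last first.
      by move=> J; rewrite andbC.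
    apply: ler_sum => J /andP[JV /eqP cJ]; rewrite normrM normr_nat normr_prod mulrA.
    rewrite ler_piMl ?prodr_ge0 // mulrC.
    apply: le_trans (bin_expr_le1 (k.+2 - j) (leq_subr #|J| _) u0 nu).
    rewrite ler_wpM2r ?exprn_ge0 // ler_nat -cJ; exact: codeg_le.
  move=> J /andP[_ nJV]; rewrite /codeg (_ : [set _ in _ | _] = set0) ?cards0 ?mul0r ?normr0 ?mulr0 //.
  apply/setP => A; rewrite !inE; apply/negbTE/negP => /andP[/HV AV JA].
  by move/negP: nJV; apply; apply: subset_trans JA AV.
apply: le_trans (elsym_le_expr _ _ _) _ => //.
rewrite /j -addn2 exprD; apply: ler_pM; rewrite ?exprn_ge0 ?sumr_ge0 ?sum_norm_sqr //.
apply: (@le_trans _ _ (2 ^+ i)); last by rewrite ler_weXn2l ?ler1n // -ltnS.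
by rewrite lerXn2r ?nnegrE ?sumr_ge0.
Qed.

Lemma deg_le H V k i : (forall A, A \in H -> A \subset V) ->
  (forall A, A \in H -> #|A| = k.+1) -> (deg H i <= 'C(#|V|.-1, k))%N.
Proof.
move=> HV Hk; rewrite /deg; apply: leq_trans (codeg_le _ HV Hk) _.
by rewrite cards1 subn1 subSS subn0.
Qed.

Lemma degE H i : deg H i = (\sum_(A in H) (i \in A))%N.
Proof.
rewrite /deg /codeg -sum1dep_card big_mkcondr /=; apply: eq_bigr => A _.
by rewrite sub1set; case: (i \in A).
Qed.

Lemma card_sum_mem V A : A \subset V -> (\sum_(i in V) (i \in A) = #|A|)%N.
Proof.
move=> /subsetP AV; rewrite -sum1_card big_mkcond [RHS]big_mkcond /=.
apply: eq_bigr => i _; case iA: (i \in A); last by case: ifP.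
by rewrite AV.
Qed.

Lemma sum_deg H V k : (forall A, A \in H -> A \subset V) ->
  (forall A, A \in H -> #|A| = k) -> (\sum_(i in V) deg H i = k * #|H|)%N.
Proof.
move=> HV Hk; rewrite mulnC -sum_nat_const.
under eq_bigr => i _ do rewrite degE.
rewrite exchange_big /=; apply: eq_bigr => A AH.
by rewrite card_sum_mem ?Hk ?HV.
Qed.

End ShiftEstimates.

(** * Weights with two distinguished vertices *)

Section RealInequalities.
Variable R : realFieldType.
Implicit Types a b c e k s x y D P Q : R.

Lemma le_half_sum a b b' : 0 <= a -> a <= 1/4 -> b <= 1 -> b' <= 1 ->
  (b + 2 * a * b') / 2 <= 1.
Proof.
move=> a0 a1 b1 b'1; have : a * b' <= a by rewrite ler_piMr.
have -> : 2 * a * b' = 2 * (a * b') by ring.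
lra.
Qed.

Lemma quarter_half a : a <= 1/4 -> a <= 1/2. Proof. lra. Qed.

Lemma one_le_two_sub a : a <= 1/4 -> 1 <= 2 * (1 - 2 * a). Proof. lra. Qed.

Lemma half_bound e x k y : 2 * e * x <= k * y -> e * x <= k / 2 * y.
Proof. by move=> h; rewrite -(ler_pM2l (ltr0n R 2)); lra. Qed.

Lemma crude_sum e1 e2 e3 f1 f2 f3 s3 k D s : e1 <= f1 - k * D -> e2 <= f2 ->
  e3 <= f3 + s + k / 2 * D -> f1 + f2 + f3 <= f1 + f2 + s3 ->
  e1 + e2 + e3 <= f1 + f2 + s3 + s - k / 2 * D.
Proof. lra. Qed.

Lemma absorb_quarter f x s k D y : f < x -> x <= f + s - k / 2 * D ->
  s <= k / 4 * D + y -> k / 4 * D <= y.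
Proof. lra. Qed.

Lemma absorb_near f f' x s c e D y : x - (f + s - c * D) <= e * D -> f <= f' ->
  s <= (c - e) * D + y -> x <= f' + y.
Proof. lra. Qed.

Lemma lower_near f x s c e : - e <= x - (f + s - c) -> f + (s - c - e) <= x.
Proof. lra. Qed.

Lemma quad_bound x y z : 0 <= x -> 4 * x <= y -> y <= z -> x <= 4 * z.
Proof. lra. Qed.

Lemma small_lt eps e k c : 0 < eps <= 1 -> 0 < k -> e <= eps / 8 * k -> k <= c -> e < c.
Proof. by move=> /andP[e0 e1] k0 h kc; nra. Qed.

(** The expansion error [e] costs each side a factor [1 - th] with [th = eps / 8]. The advantage
    [1 + eps] pays for both and for the surplus, since
    [(1 + eps) (1 - th) (1 - th - eps/4) >= 1]. *)
Lemma gap_bound eps e k c P Q : 0 < k -> k <= c -> c <= 1 -> 0 < eps <= 1 ->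
  0 <= P -> (1 + eps) * P <= Q -> 0 <= e -> e <= eps / 8 * k ->
  P / (4 * (c - e)) + Q * eps / 16 <= Q / (4 * c) * (1 - e / c).
Proof.
move=> k0 kc c1 /andP[eps0 eps1] P0 QP eta0 etak.
have c0 : 0 < c := lt_le_trans k0 kc.
have etac : e <= eps / 8 * c.
  by apply: le_trans etak _; rewrite ler_wpM2l // divr_ge0 // ltW.
have Q0 : 0 <= Q by apply: le_trans QP; rewrite mulr_ge0 // addr_ge0 // ltW.
pose th := eps / 8; have th0 : 0 < th by rewrite divr_gt0 ?ltr0n.
have th1 : th <= 1/8 by rewrite /th; lra.
have t1 : 0 < 1 - th by lra.
have ce : c * (1 - th) <= c - e by rewrite mulrBr mulr1 lerD2l lerN2 mulrC.
have s1 : P / (4 * (c - e)) <= P / (4 * c * (1 - th)).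
  rewrite ler_wpM2l // lef_pV2 ?posrE ?mulr_gt0 ?ltr0n //.
    by rewrite -mulrA ler_pM2l ?ltr0n.
  by apply: lt_le_trans ce; rewrite mulr_gt0.
have s2 : Q / (4 * c) * (1 - th) <= Q / (4 * c) * (1 - e / c).
  apply: ler_wpM2l; first by rewrite divr_ge0 // mulr_ge0 // ltW.
  by rewrite lerD2l lerN2 ler_pdivrMr.
have s3 : P / (1 - th) + Q * eps / 4 <= Q * (1 - th).
  rewrite -(ler_pM2r t1) mulrDl divfK ?gt_eqF //.
  have e1 : 0 < 1 + eps by lra.
  rewrite -(ler_pM2l e1).
  apply: (@le_trans _ _ (Q + (1 + eps) * (Q * eps / 4 * (1 - th)))).
    by rewrite mulrDr lerD2r.
  rewrite -subr_ge0.
  rewrite (_ : _ - _ = Q * ((1 + eps) * (1 - th) * (1 - th - eps / 4) - 1)); last by ring.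
  by rewrite mulr_ge0 // /th; nra.
apply: le_trans s2; apply: le_trans (lerD s1 (lexx _)) _.
have e4 : 0 < 4 * c by rewrite mulr_gt0 ?ltr0n.
rewrite -(ler_pM2l e4) mulrDr.
have -> : 4 * c * (P / (4 * c * (1 - th))) = P / (1 - th).
  by field; rewrite !gt_eqF.
have -> : 4 * c * (Q / (4 * c) * (1 - th)) = Q * (1 - th) by field; rewrite gt_eqF.
apply: le_trans s3; rewrite lerD2l.
rewrite (_ : 4 * c * _ = c * (Q * eps / 4)); last by field.
by rewrite ler_piMl // divr_ge0 // mulr_ge0 // ltW.
Qed.

End RealInequalities.

Section PairValue.
Variables (R : rcfType) (T : finType) (V : {set T}) (k : nat).
Implicit Types (H C G : {set {set T}}) (x d : T -> R) (a u rho : R).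
Local Notation n := #|V|.

(* The weight of [pair_graph p q k H], defined below, when [p] and [q] have weight [a]. *)
Definition pair_value H a x : R :=
  elsym V k.+4 x + 2 * a * elsym V k.+3 x + a ^+ 2 * wsum H x.

Definition flat_value s a u : R :=
  'C(n, k.+4)%:R * u ^+ k.+4 + 2 * a * ('C(n, k.+3)%:R * u ^+ k.+3)
  + a ^+ 2 * (s * u ^+ k.+2).

(** Twice the coefficient sums the two [elsym] terms; the quadratic part of [wsum H] is left to the
    error, and so this does not depend on [H]. *)
Definition curvature a u : R :=
  ('C(n - 2, k.+2)%:R * u ^+ k.+2 + 2 * a * ('C(n - 2, k.+1)%:R * u ^+ k.+1)) / 2.

Definition uniform_family H :=
  (forall A, A \in H -> A \subset V) /\ (forall A, A \in H -> #|A| = k.+2).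

Definition sqdeg H : R := \sum_(i in V) (deg H i)%:R ^+ 2.

(** Twice the constant of [elsym_shift_bound] for [elsym V k.+4]; the doubling covers the other two
    terms of [pair_value]. *)
Definition err : R := k.+2%:R * 2 ^+ k.+4.+1.

Lemma pair_value_estimate H a u d rho : uniform_family H ->
  0 <= u -> n%:R * u <= 1 -> 0 <= a <= 1/2 -> 0 <= rho <= 1 ->
  \sum_(i in V) d i = 0 -> \sum_(i in V) d i ^+ 2 = rho ^+ 2 ->
  \sum_(i in V) `|d i| <= 2 ->
  `|pair_value H a (fun i => u + d i) -
    (flat_value #|H|%:R a u + a ^+ 2 * u ^+ k.+1 * (\sum_(i in V) (deg H i)%:R * d i)
     - curvature a u * rho ^+ 2)|
  <= err * (rho + a ^+ 2 * n%:R) * rho ^+ 2.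
Proof.
move=> [HV Hk] u0 nu /andP[a0 a1] rho01 sd0 sd2 sd.
have h1 := elsym_shift_bound k.+2 u0 nu rho01 sd0 sd2.
have h2 := elsym_shift_bound k.+1 u0 nu rho01 sd0 sd2.
have h3 := wsum_shift_bound u0 nu HV Hk sd.
rewrite sd2 in h3.
rewrite /pair_value /flat_value /curvature.
set E1 := elsym _ _ _ in h1 *; set E2 := elsym _ _ _ in h2 *; set E3 := wsum _ _ in h3 *.
set b1 := (X in `|_ - X|) in h1; set b2 := (X in `|_ - X|) in h2.
set b3 := (X in `|_ - X|) in h3.
rewrite (_ : _ - _ = (E1 - b1) + 2 * a * (E2 - b2) + a ^+ 2 * (E3 - b3)); last first.
  by rewrite /b1 /b2 /b3; field.
case/andP: rho01 => rho0 rho1.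
have a20 : 0 <= a ^+ 2 by apply: sqr_ge0.
have r3 : 0 <= rho ^+ 3 by apply: exprn_ge0.
have r2 : 0 <= rho ^+ 2 by apply: exprn_ge0.
apply: le_trans (ler_normD _ _) _.
apply: le_trans (lerD (ler_normD _ _) (lexx _)) _.
rewrite (normrM (2 * a)) (normrM 2 a) (normrM (a ^+ 2)) (ger0_norm a20) (ger0_norm a0) normr_nat.
apply: le_trans (lerD (lerD h1 (ler_wpM2l _ h2)) (ler_wpM2l a20 h3)) _; first by lra.
have p2 : 1 <= 2 ^+ k :> R by rewrite exprn_ege1 // ler1n.
have kk : 0 <= k%:R :> R by rewrite ler0n.
have k1 : k.+1%:R = k%:R + 1 :> R by rewrite natr1.
have k2 : k.+2%:R = k%:R + 2 :> R by rewrite -addn2 natrD.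
rewrite /err k1 k2 !(exprS 2); set P := 2 ^+ k in p2 *.
set N := n%:R; have N0 : 0 <= N by rewrite ler0n.
rewrite -subr_ge0.
rewrite (_ : _ - _ = 16 * P * (rho ^+ 3) * ((k%:R + 2) - (k%:R+1) * a) + 
   a ^+ 2 * N * rho ^+ 2 * P * (31 * k%:R + 63)); last by ring.
have ka : (k%:R + 1) * a <= k%:R + 1.
  by rewrite ler_piMr; lra.
apply: addr_ge0; rewrite mulr_ge0 ?mulr_ge0 //; lra.
Qed.


(** Completes the square at each vertex, ignoring the constraint that [d] sums to 0. Hence the upper
    bounds involve [sqdeg] where the exact optimum would give the variance. *)
Lemma amgm_sum H d p c : 0 < c ->
  p * (\sum_(i in V) (deg H i)%:R * d i) <=
  c * (\sum_(i in V) d i ^+ 2) + p ^+ 2 * sqdeg H / (4 * c).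
Proof.
move=> c0; rewrite /sqdeg !mulr_sumr mulr_suml -big_split /=; apply: ler_sum => i _.
rewrite -subr_ge0 (_ : _ - _ = (2 * c * d i - p * (deg H i)%:R) ^+ 2 / (4 * c)).
  by rewrite divr_ge0 ?sqr_ge0 // mulr_ge0 // ltW.
by field; rewrite gt_eqF.
Qed.

Section Estimates.
Variables (a u L kap : R).
Hypotheses (n0 : (0 < n)%N) (u0 : 0 <= u) (nu : n%:R * u = 1 - 2 * a).
Hypotheses (a0 : 0 <= a) (a4 : a <= 1/4) (aL : a * n%:R <= L).
Hypotheses (kap0 : 0 < kap)
  (kapc : kap <= 'C(n - 2, k.+2)%:R * u ^+ k.+2 / (k.+4 * k.+3)%:R).
(** All three say that [n] is large. [n1] confines near-optimal points to distance [1/n] from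
    uniform, [n2] lets half of the curvature absorb the error of [wsum_shift_bound], and [n3] keeps
    the witness of [pair_value_ge] nonnegative. *)
Hypotheses (n1 : 4 * L ^+ 4 <= kap ^+ 2 * n%:R) (n2 : 2 * err * L ^+ 2 <= kap * n%:R)
  (n3 : L ^+ 2 <= kap * n%:R).

Let p := a ^+ 2 * u ^+ k.+1.
Let c := curvature a u.
(** The error factor of [pair_value_estimate] once [rho <= 1/n] and [a^2 n <= L^2 / n]. *)
Let eta := err * (1 + L ^+ 2) / n%:R.

Let n0R : 0 < n%:R :> R. Proof. by rewrite ltr0n. Qed.
Let nu1 : n%:R * u <= 1. Proof. by rewrite nu gerBl mulr_ge0. Qed.
Let p0 : 0 <= p. Proof. by rewrite mulr_ge0 ?sqr_ge0 ?exprn_ge0. Qed.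

Lemma err_ge0 : 0 <= err. Proof. by rewrite mulr_ge0 ?exprn_ge0. Qed.

Lemma curvature_ge : kap <= c.
Proof.
have h1 : 0 <= 'C(n - 2, k.+2)%:R * u ^+ k.+2 by rewrite mulr_ge0 ?exprn_ge0.
have h2 : 0 <= 2 * a * ('C(n - 2, k.+1)%:R * u ^+ k.+1).
  by rewrite !mulr_ge0 ?exprn_ge0.
apply: le_trans kapc _; rewrite /c /curvature; apply: (@le_trans _ _ ('C(n - 2, k.+2)%:R * u ^+ k.+2 / 2)).
  rewrite ler_wpM2l // lef_pV2 ?posrE ?ltr0n // ler_nat.
  exact: (@leq_mul 2 1 k.+4 k.+3).
by rewrite ler_pM2r ?invr_gt0 ?ltr0n // lerDl.
Qed.

Lemma curvature_le1 : c <= 1.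
Proof.
have h1 := @bin_expr_le1 R n (n - 2) k.+2 u (leq_subr _ _) u0 nu1.
have h2 := @bin_expr_le1 R n (n - 2) k.+1 u (leq_subr _ _) u0 nu1.
by apply: le_half_sum; rewrite ?a0.
Qed.

Lemma p_deg_le H i : uniform_family H -> p * (deg H i)%:R <= a ^+ 2.
Proof.
move=> [HV Hk]; rewrite /p -mulrA ler_piMr ?sqr_ge0 //.
have := @bin_expr_le1 R n n.-1 k.+1 u (leq_pred _) u0 nu1; apply: le_trans.
by rewrite mulrC ler_wpM2r ?exprn_ge0 // ler_nat (deg_le _ HV Hk).
Qed.

(** The quadratic gain is thus of order [n^-3], so the optimal displacement has squared norm below
    [n^-2], as [pair_value_near] requires. *)
Lemma p_sqdeg_le H : uniform_family H -> p ^+ 2 * sqdeg H * n%:R ^+ 3 <= L ^+ 4.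
Proof.
move=> UH; apply: (@le_trans _ _ ((a * n%:R) ^+ 4)); last first.
  by rewrite lerXn2r ?nnegrE ?mulr_ge0 // (le_trans _ aL) ?mulr_ge0.
rewrite (_ : (a * _) ^+ 4 = a ^+ 4 * n%:R * n%:R ^+ 3); last by ring.
rewrite ler_wpM2r ?exprn_ge0 // /sqdeg mulr_sumr.
apply: (@le_trans _ _ (\sum_(i in V) a ^+ 4)); last by rewrite sumr_const mulr_natr.
apply: ler_sum => i _; rewrite -exprMn (_ : a ^+ 4 = (a ^+ 2) ^+ 2); last by ring.
by apply: lerXn2r; rewrite ?nnegrE; [exact: mulr_ge0 | exact: sqr_ge0 | exact: p_deg_le].
Qed.

Lemma sum_norm_dev x : (forall i, 0 <= x i) -> \sum_(i in V) x i = n%:R * u ->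
  \sum_(i in V) `|x i - u| <= 2.
Proof.
move=> x0 sx; apply: (@le_trans _ _ (\sum_(i in V) (x i + u))).
  apply: ler_sum => i _; apply: le_trans (ler_normB _ _) _.
  by rewrite !ger0_norm.
by rewrite big_split /= sx sumr_const -[u *+ _]mulr_natl (_ : 2 = 1 + 1) // lerD.
Qed.

Lemma sum_dev x : \sum_(i in V) x i = n%:R * u -> \sum_(i in V) (x i - u) = 0.
Proof. by move=> sx; rewrite sumrB sx sumr_const mulr_natl subrr. Qed.

Lemma pair_value_near H x : uniform_family H ->
  (forall i, 0 <= x i) -> \sum_(i in V) x i = n%:R * u ->
  sqdist V u x * n%:R ^+ 2 <= 1 ->
  `|pair_value H a x - (flat_value #|H|%:R a u +
      p * (\sum_(i in V) (deg H i)%:R * (x i - u)) - c * sqdist V u x)|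
  <= eta * sqdist V u x.
Proof.
move=> UH x0 sx Dn; have D0 := sqdist_ge0 V u x.
set D := sqdist V u x in Dn D0 *; pose rho := Num.sqrt D.
have rD : rho ^+ 2 = D by rewrite sqr_sqrtr.
have rho0 : 0 <= rho by apply: sqrtr_ge0.
have rn : rho * n%:R <= 1.
  by rewrite -(@ler_pXn2r _ 2) ?nnegrE ?mulr_ge0 // exprMn rD expr1n.
have rho1 : 0 <= rho <= 1.
  by rewrite rho0 /= (le_trans _ rn) // ler_peMr // ler1n.
have a12 : 0 <= a <= 1/2 by rewrite a0; apply: quarter_half.
have e : pair_value H a x = pair_value H a (fun i => u + (x i - u)).
  by rewrite /pair_value; congr (_ + _ * _ + _ * _); apply: eq_bigr => A _;
     apply: eq_bigr => i _; rewrite addrCA subrr addr0.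
have := pair_value_estimate UH u0 nu1 a12 rho1 (sum_dev sx) (esym rD) (sum_norm_dev x0 sx).
rewrite -e rD => /le_trans; apply.
rewrite ler_wpM2r // /eta -mulrA ler_wpM2l ?err_ge0 // ler_pdivlMr // mulrDl.
rewrite lerD // (_ : _ * _ * _ = (a * n%:R) ^+ 2); last by ring.
by rewrite lerXn2r ?nnegrE ?mulr_ge0 // (le_trans _ aL) ?mulr_ge0.
Qed.

(* A global (non-sharp) estimate first forces [x] to be close to uniform, where the
   second-order expansion is sharp. *)
Lemma pair_value_le H s x : uniform_family H -> #|H|%:R <= s ->
  (forall i, 0 <= x i) -> \sum_(i in V) x i = n%:R * u -> eta < c ->
  pair_value H a x <= flat_value s a u + p ^+ 2 * sqdeg H / (4 * (c - eta)).
Proof.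
move=> UH Hs x0 sx etac; have [HV Hk] := UH.
have sq0 : 0 <= sqdeg H by apply: sumr_ge0 => i _; apply: sqr_ge0.
have fs : flat_value #|H|%:R a u <= flat_value s a u.
  by rewrite /flat_value lerD2l ler_wpM2l ?sqr_ge0 // ler_wpM2r ?exprn_ge0.
have D0 := sqdist_ge0 V u x.
(* In the second case the crude upper bound is played against [big], which turns it into an upper
   bound for the distance [D]. *)
have [small|big] := leP (pair_value H a x) (flat_value s a u).
  apply: le_trans small _; rewrite lerDl; apply: divr_ge0.
    by apply: mulr_ge0 => //; apply: sqr_ge0.
  by apply: mulr_ge0 => //; rewrite subr_ge0 ltW.
set D := sqdist V u x in D0 *.
set Sg := \sum_(i in V) (deg H i)%:R * (x i - u).
have crude : pair_value H a x <= flat_value s a u + p * Sg - kap / 2 * D.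
  have h1 := elsym_deficit k.+2 x0 n0 sx u0.
  have h2 := elsym_maclaurin k.+3 x0 n0 sx u0.
  have h3 := wsum_shift_bound u0 nu1 HV Hk (sum_norm_dev x0 sx).
  have e : wsum H x = wsum H (fun i => u + (x i - u)).
    by apply: eq_bigr => A _; apply: eq_bigr => i _; rewrite addrCA subrr addr0.
  rewrite -e -/Sg -/(sqdist V u x) -/D in h3.
  have h1' : elsym V k.+4 x <= 'C(n, k.+4)%:R * u ^+ k.+4 - kap * D.
    by apply: le_trans h1 _; rewrite lerD2l lerN2 ler_wpM2r.
  have h3' : a ^+ 2 * wsum H x <= a ^+ 2 * (#|H|%:R * u ^+ k.+2) + p * Sg + kap / 2 * D.
    have : wsum H x <= (#|H|%:R * u ^+ k.+2 + u ^+ k.+1 * Sg) + err * (n%:R * D).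
      rewrite -lerBlDl; apply: le_trans (ler_norm _) _; apply: le_trans h3 _.
      rewrite ler_wpM2r ?mulr_ge0 // /err; apply: ler_pM; rewrite ?exprn_ge0 ?ler_nat //.
      by rewrite ler_weXn2l ?ler1n //; apply: (leq_addl 5 k).
    move=> /(ler_wpM2l (sqr_ge0 a)) /le_trans; apply.
    have -> : a ^+ 2 * (#|H|%:R * u ^+ k.+2 + u ^+ k.+1 * Sg + err * (n%:R * D)) =
        a ^+ 2 * (#|H|%:R * u ^+ k.+2) + p * Sg + (err * (a * n%:R) ^+ 2 / n%:R) * D.
      by rewrite /p; field; rewrite gt_eqF.
    rewrite lerD2l ler_wpM2r // ler_pdivrMr //.
    apply: (@le_trans _ _ (err * L ^+ 2)); last by exact: half_bound.
    by rewrite ler_wpM2l ?err_ge0 // lerXn2r ?nnegrE ?mulr_ge0 // (le_trans _ aL) ?mulr_ge0.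
  have h2' : 2 * a * elsym V k.+3 x <= 2 * a * ('C(n, k.+3)%:R * u ^+ k.+3).
    by rewrite ler_wpM2l ?mulr_ge0.
  exact: crude_sum h1' h2' h3' fs.
have am c' : 0 < c' -> p * Sg <= c' * D + p ^+ 2 * sqdeg H / (4 * c').
  exact: (amgm_sum H (fun i => x i - u)).
(* Taking [c' = kap / 4] leaves [kap / 4 * D] on the left, whence [D <= 4 L^4 / (kap^2 n^3)], and
   [n1] concludes. *)
have Dn : D * n%:R ^+ 2 <= 1.
  have k4 : 0 < kap / 4 by rewrite divr_gt0 ?ltr0n.
  have := am _ k4; rewrite (_ : 4 * (kap / 4) = kap); last by field.
  move=> h.
  have : kap / 4 * D <= p ^+ 2 * sqdeg H / kap by exact: absorb_quarter big crude h.
  rewrite ler_pdivlMr // => h'.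
  have h4 := p_sqdeg_le UH.
  have kn : 0 < kap ^+ 2 * n%:R by rewrite mulr_gt0 ?exprn_gt0.
  rewrite -(ler_pM2l kn) mulr1; apply: le_trans n1.
  rewrite [leLHS](_ : _ = 4 * (kap / 4 * D * kap * n%:R ^+ 3)); last by field.
  rewrite ler_pM2l ?ltr0n //; apply: le_trans h4.
  by rewrite ler_wpM2r ?exprn_ge0.
have := pair_value_near UH x0 sx Dn; rewrite -/D -/Sg ler_norml => /andP[_ h].
have ce : 0 < c - eta by rewrite subr_gt0.
exact: absorb_near h fs (am _ ce).
Qed.

(** For a uniform family the degrees add up to [k.+2 * #|H|], so this is the sum of squared
    deviations from the mean degree, not divided by [n]. *)
Definition deg_variance H : R := sqdeg H - (k.+2%:R * #|H|%:R) ^+ 2 / n%:R.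

(* The witness maximises the quadratic approximation: its deviation from [u] at [i] is
   [p / (2 c)] times the deviation of [deg H i] from the mean degree. *)
Lemma pair_value_ge H : uniform_family H -> exists x : T -> R,
  [/\ forall i, 0 <= x i, \sum_(i in V) x i = n%:R * u &
    flat_value #|H|%:R a u + p ^+ 2 * deg_variance H / (4 * c) * (1 - eta / c)
    <= pair_value H a x].
Proof.
move=> UH; have [HV Hk] := UH.
have c0 : 0 < c := lt_le_trans kap0 curvature_ge.
have c20 : 0 < 2 * c by apply: mulr_gt0.
pose m : R := k.+2%:R * #|H|%:R / n%:R.
pose ka := p / (2 * c).
pose x i := u + ka * ((deg H i)%:R - m).
have ka0 : 0 <= ka by rewrite divr_ge0 // mulr_ge0 // ltW.
have sdeg : \sum_(i in V) (deg H i)%:R = n%:R * m :> R.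
  rewrite -natr_sum (sum_deg HV Hk) natrM /m; field; by rewrite gt_eqF.
have m0 : 0 <= m by rewrite divr_ge0 ?mulr_ge0.
have pm : p * m <= a ^+ 2.
  rewrite -(ler_pM2l n0R) mulrCA -sdeg mulr_sumr mulr_natl -[_ *+ n]sumr_const.
  by apply: ler_sum => i _; apply: p_deg_le.
(* Only the subtracted mean can do harm: [ka * m <= a^2 / (2c)], while [a^2 n^2 <= L^2 <= kap n] and
   [u] is at least [1 / (2n)]. *)
have x0 i : 0 <= x i.
  rewrite /x mulrBr addrA addrAC; apply: addr_ge0; last by rewrite mulr_ge0.
  rewrite subr_ge0 /ka mulrAC ler_pdivrMr //.
  apply: le_trans pm _.
  have : kap * n%:R <= c * n%:R by rewrite ler_wpM2r ?curvature_ge.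
  move=> kc; rewrite -(@ler_pM2r _ (n%:R ^+ 2)) ?exprn_gt0 // -exprMn.
  apply: (@le_trans _ _ (L ^+ 2)).
    by rewrite lerXn2r ?nnegrE ?mulr_ge0 // (le_trans _ aL) ?mulr_ge0.
  apply: (le_trans n3); apply: (le_trans kc).
  rewrite [leRHS](_ : _ = (c * n%:R) * (2 * (n%:R * u))); last by ring.
  by apply: ler_peMr; [exact: mulr_ge0 (ltW c0) _ | rewrite nu; apply: one_le_two_sub].
have sx : \sum_(i in V) x i = n%:R * u.
  by rewrite big_split /= -mulr_sumr sumrB sdeg !sumr_const !mulr_natl subrr mulr0 addr0.
have eQ : deg_variance H = sqdeg H - n%:R * m ^+ 2.
  by rewrite /deg_variance /m; field; rewrite gt_eqF.
have eD : sqdist V u x = ka ^+ 2 * deg_variance H.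
  rewrite eQ /sqdist (eq_bigr (fun i => ka ^+ 2 * ((deg H i)%:R ^+ 2 - 2 * m * (deg H i)%:R + m ^+ 2))).
    rewrite -mulr_sumr big_split /= sumrB -mulr_sumr sdeg sumr_const -[m ^+ 2 *+ _]mulr_natl -/(sqdeg H).
    ring.
  by move=> i _; rewrite /x; ring.
have eS : \sum_(i in V) (deg H i)%:R * (x i - u) = ka * deg_variance H.
  rewrite eQ (eq_bigr (fun i => ka * ((deg H i)%:R ^+ 2 - m * (deg H i)%:R))).
    rewrite -mulr_sumr sumrB -mulr_sumr sdeg -/(sqdeg H); ring.
  by move=> i _; rewrite /x; ring.
exists x; split=> //.
have Dn : sqdist V u x * n%:R ^+ 2 <= 1.
  have h4 := p_sqdeg_le UH.
  have QP : deg_variance H <= sqdeg H.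
    by rewrite /deg_variance gerBl divr_ge0 ?sqr_ge0.
  have h5 : p ^+ 2 * deg_variance H * n%:R ^+ 3 <= L ^+ 4.
    by apply: le_trans h4; rewrite ler_wpM2r ?exprn_ge0 // ler_wpM2l ?sqr_ge0.
  rewrite eD /ka.
  rewrite [leLHS](_ : _ = (p ^+ 2 * deg_variance H * n%:R ^+ 3) / (4 * c ^+ 2 * n%:R)); last first.
    by field; rewrite !gt_eqF.
  rewrite ler_pdivrMr ?mul1r; last by rewrite mulr_gt0 // mulr_gt0 // exprn_gt0.
  apply: le_trans h5 _.
  have kc2 : kap ^+ 2 * n%:R <= c ^+ 2 * n%:R.
    by rewrite ler_wpM2r // lerXn2r ?nnegrE ?curvature_ge // ltW.
  have L4 : 0 <= L ^+ 4 by rewrite (_ : 4 = (2 * 2)%N)%N // exprM sqr_ge0.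
  by rewrite -mulrA; apply: quad_bound L4 n1 kc2.
have := pair_value_near UH x0 sx Dn; rewrite ler_norml => /andP[h _].
rewrite eS eD in h.
have -> : p ^+ 2 * deg_variance H / (4 * c) * (1 - eta / c) =
   p * (ka * deg_variance H) - c * (ka ^+ 2 * deg_variance H) - eta * (ka ^+ 2 * deg_variance H).
  by rewrite /ka; field; rewrite gt_eqF.
exact: lower_near.
Qed.

(** Both families are tested with the same [a] and the same mass on [V]; the flat values are then
    ordered by cardinality, and only the quadratic gains have to be compared. *)
Lemma pair_value_compare C G x eps : uniform_family C -> uniform_family G ->
  (#|C| <= #|G|)%N -> 0 < eps <= 1 ->
  (1 + eps) * sqdeg C <= deg_variance G -> eta <= eps / 8 * kap ->
  (forall i, 0 <= x i) -> \sum_(i in V) x i = n%:R * u ->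
  exists y : T -> R, [/\ forall i, 0 <= y i, \sum_(i in V) y i = n%:R * u &
    pair_value C a x + p ^+ 2 * deg_variance G * eps / 16 <= pair_value G a y].
Proof.
move=> UC UG CG /andP[eps0 eps1] QP etak x0 sx.
have kc := curvature_ge; have c1 := curvature_le1.
have c0 : 0 < c := lt_le_trans kap0 kc.
have eta0 : 0 <= eta.
  by rewrite divr_ge0 // mulr_ge0 ?err_ge0 // addr_ge0 // sqr_ge0.
have etac' : eta < c by apply: small_lt etak kc; rewrite ?eps0.
have CGR : #|C|%:R <= #|G|%:R :> R by rewrite ler_nat.
have hC := pair_value_le UC CGR x0 sx etac'.
have [y [y0 sy hG]] := pair_value_ge UG.
exists y; split=> //; apply: le_trans hG; apply: (le_trans (lerD hC (lexx _))).
rewrite -addrA lerD2l.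
set Q := deg_variance G in QP *; set P := sqdeg C in QP *.
have P0 : 0 <= P by apply: sumr_ge0 => i _; apply: sqr_ge0.
have Q0 : 0 <= Q by apply: le_trans QP; rewrite mulr_ge0 // addr_ge0 // ltW.
have s4 : P / (4 * (c - eta)) + Q * eps / 16 <= Q / (4 * c) * (1 - eta / c).
  by apply: gap_bound kc c1 _ P0 QP eta0 etak; rewrite ?eps0.
have p20 : 0 <= p ^+ 2 by apply: sqr_ge0.
have := ler_wpM2l p20 s4; rewrite mulrDr !mulrA //.
Qed.

End Estimates.
End PairValue.

(** * Families with a large sum of squared degrees *)

Local Close Scope ring_scope.

Section DegreeSquares.
Variables (T : finType) (V : {set T}).
Implicit Types (H : {set {set T}}) (A B J : {set T}).

Definition sqdegn H : nat := \sum_(i in V) deg H i ^ 2.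

Lemma sqdegnE H : (forall A, A \in H -> A \subset V) ->
  sqdegn H = \sum_(A in H) \sum_(B in H) #|A :&: B|.
Proof.
move=> HV; rewrite /sqdegn.
under eq_bigr => i _ do rewrite expnS expn1 !degE big_distrlr /=.
rewrite exchange_big /=; apply: eq_bigr => A AH.
rewrite exchange_big /=; apply: eq_bigr => B BH.
rewrite -(@card_sum_mem _ V (A :&: B)).
  by apply: eq_bigr => i _; rewrite inE mulnb.
by apply: subset_trans (subsetIl _ _) (HV _ AH).
Qed.

(** With all distinct members meeting in [k + 1] points, [sqdegnE] would give [k.+1 * s ^ 2 + s].
    The pair [A1], [B1] loses at least 1 in each of its two orders. *)
Lemma sqdegn_le_nonsunflower H k s A1 B1 : uniform_family V k H ->
  #|H| <= s -> A1 \in H -> B1 \in H -> #|A1 :&: B1| <= k ->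
  sqdegn H + 2 <= k.+1 * s ^ 2 + s.
Proof.
move=> [HV Hk] Hs A1H B1H cAB.
have AB1 : A1 != B1.
  by apply/eqP => e; move: cAB; rewrite e setIid Hk // ltnNge leqnSn.
apply: (@leq_trans (k.+1 * #|H| ^ 2 + #|H|)); last first.
  by rewrite leq_add // leq_mul // leq_exp2r.
rewrite sqdegnE //.
have e2 : \sum_(A in H) \sum_(B in H)
   ((A == A1) && (B == B1) + (A == B1) && (B == A1)) = 2.
  under eq_bigr => A _ do rewrite big_split /=.
  rewrite big_split /=.
  have ind X Y : X \in H -> Y \in H ->
     \sum_(A in H) \sum_(B in H) ((A == X) && (B == Y)) = 1.
    move=> XH YH; rewrite (bigD1 X) //= [X in _ + X]big1 ?addn0.
      rewrite (bigD1 Y) //= [X in _ + X]big1 ?addn0 ?eqxx //.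
      by move=> B /andP[_ /negPf ->]; rewrite andbF.
    by move=> A /andP[_ /negPf ->]; rewrite big1.
  by rewrite !ind.
have e3 : \sum_(A in H) \sum_(B in H) (k.+1 + (A == B)) = k.+1 * #|H| ^ 2 + #|H|.
  rewrite (eq_bigr (fun=> #|H| * k.+1 + 1)).
    by rewrite sum_nat_const mulnDr muln1 expnS expn1; lia.
  move=> A AH; rewrite big_split /= sum_nat_const; congr (_ + _).
  rewrite (bigD1 A) //= eqxx big1 ?addn0 // => B /andP[_ BA].
  by rewrite eq_sym (negPf BA).
rewrite -[X in _ + X]e2 -e3 -big_split /=; apply: leq_sum => A AH.
rewrite -big_split /=; apply: leq_sum => B BH.
have [<-|AB] := eqVneq A B.
  have -> : (A == A1) && (A == B1) + (A == B1) && (A == A1) = 0.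
    by have [->|_] := eqVneq A A1; rewrite ?(negPf AB1) ?andbF.
  by rewrite setIid Hk // addn0 addn1.
have lt : #|A :&: B| <= k.+1.
  rewrite -ltnS -(Hk _ AH) ltn_neqAle subset_leq_card ?subsetIl // andbT.
  apply: contra AB => /eqP e.
  have sAB : A \subset B.
    by apply/setIidPl/eqP; rewrite eqEcard subsetIl /= e leqnn.
  by rewrite eqEcard sAB (Hk _ AH) (Hk _ BH) leqnn.
rewrite addn0; have [eA|nA1] := eqVneq A A1.
  rewrite eA (negPf AB1) /= addn0; case: (eqVneq B B1) => [->|_]; last by rewrite addn0 -eA.
  by rewrite addn1 ltnS.
rewrite /= add0n; have [eA|_] := eqVneq A B1; last by rewrite addn0.
case: (eqVneq B A1) => [->|_]; last by rewrite addn0.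
by rewrite eA setIC addn1 ltnS.
Qed.

Lemma sqdegn_le_max H k m : uniform_family V k H ->
  (forall i, deg H i <= m) -> sqdegn H <= m * (k.+2 * #|H|).
Proof.
move=> [HV Hk] dm; rewrite -(sum_deg HV Hk) big_distrr /=.
by apply: leq_sum => i _; rewrite expnS expn1 leq_mul.
Qed.

(** The degrees over [J] add up to at least [#|H|]; Cauchy-Schwarz on [J] does the rest. *)
Lemma sqdegn_ge_cover H J : J \subset V ->
  (forall A, A \in H -> 0 < #|A :&: J|) -> #|H| ^ 2 <= #|J| * sqdegn H.
Proof.
move=> JV HJ.
have h1 : #|H| <= \sum_(i in J) deg H i.
  under eq_bigr do rewrite degE.
  rewrite exchange_big /= -sum1_card; apply: leq_sum => A /HJ AJ.
  apply: leq_trans AJ _; rewrite -(@card_sum_mem _ J (A :&: J)) ?subsetIr //.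
  by apply: leq_sum => i iJ; rewrite inE iJ andbT.
have h2 : (\sum_(i in J) deg H i) ^ 2 <= #|J| * \sum_(i in J) deg H i ^ 2.
  have := @sum_norm_sqr rat T J (fun i => (deg H i)%:R%R).
  rewrite (eq_bigr (fun i => (deg H i)%:R%R)); last by move=> i _; rewrite normr_nat.
  rewrite [X in (_ <= _ * X)%R](eq_bigr (fun i => (deg H i ^ 2)%:R%R)); last first.
    by move=> i _; rewrite natrX.
  by rewrite -!natr_sum -natrX -natrM ler_nat.
apply: leq_trans (_ : (\sum_(i in J) deg H i) ^ 2 <= _); first by rewrite leq_exp2r.
apply: leq_trans h2 _; rewrite leq_mul // /sqdegn.
rewrite [X in _ <= X](bigID (fun i => i \in J)) /=.
apply: leq_trans (leq_addr _ _); rewrite big_mkcond [X in _ <= X]big_mkcond /=.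
by apply: leq_sum => i _; case: ifP => // iJ; rewrite (subsetP JV).
Qed.

Lemma exists_subset_card (X : {set {set T}}) s : s <= #|X| ->
  exists2 Y : {set {set T}}, Y \subset X & #|Y| = s.
Proof.
move=> sX; exists [set x in take s (enum X)].
  by apply/subsetP => x; rewrite inE => /mem_take; rewrite mem_enum.
rewrite cardsE (card_uniqP _) ?take_uniq ?enum_uniq // size_take -cardE.
by case: ltngtP sX.
Qed.

Lemma exists_covered_family J k s : J \subset V ->
  s + 'C(#|V| - #|J|, k.+2) <= 'C(#|V|, k.+2) ->
  exists H : {set {set T}},
    [/\ uniform_family V k H, #|H| = s & s ^ 2 <= #|J| * sqdegn H].
Proof.
move=> JV hs; pose X := layer V k.+2 :\: layer (V :\: J) k.+2.
have cX : s <= #|X|.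
  rewrite cardsD (setIidPr _) ?card_layer.
    by rewrite cardsD (setIidPr JV); lia.
  apply/subsetP => A; rewrite !inE => /andP[AVJ ->].
  by rewrite (subset_trans AVJ) // subsetDl.
have [Y YX cY] := exists_subset_card cX; exists Y; split=> //.
  split=> A /(subsetP YX); rewrite !inE => /andP[_ /andP[AV /eqP]] //.
rewrite -cY; apply: sqdegn_ge_cover => // A /(subsetP YX).
rewrite !inE => /andP[h /andP[AV cA]]; rewrite cA andbT in h.
rewrite card_gt0; apply: contra h => /eqP e.
by rewrite subsetD AV -setI_eq0 e eqxx.
Qed.

Lemma exists_sunflower (B0 J : {set T}) k s : B0 \subset V -> J \subset V ->
  #|B0| = k.+1 -> #|J| = s -> [disjoint B0 & J] ->
  exists H : {set {set T}},
    [/\ uniform_family V k H, #|H| = s & k.+1 * s ^ 2 + s <= sqdegn H].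
Proof.
move=> B0V JV cB cJ dBJ; pose H := [set j |: B0 | j in J].
have nB j : j \in J -> j \notin B0.
  by move=> jJ; apply: contraL jJ => jB; rewrite (disjointFr dBJ).
have inj : {in J &, injective (fun j => j |: B0)}.
  move=> j l jJ lJ /= e; have : j \in l |: B0 by rewrite -e setU11.
  by rewrite in_setU1 (negPf (nB _ jJ)) orbF => /eqP.
have cH : #|H| = s by rewrite card_in_imset.
exists H; split=> //.
  split=> A /imsetP[j jJ ->]; last by rewrite cardsU1 nB // cB.
  by rewrite subUset sub1set (subsetP JV) //.
have dB i : i \in B0 -> deg H i = s.
  move=> iB; rewrite -cH /deg /codeg; apply: eq_card => A; rewrite inE andb_idr //.
  by move=> /imsetP[j _ ->]; rewrite sub1set inE iB orbT.
have dJ i : i \in J -> 0 < deg H i.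
  move=> iJ; rewrite /deg /codeg card_gt0; apply/set0Pn; exists (i |: B0).
  by rewrite inE sub1set setU11 andbT; apply/imsetP; exists i.
have sub : J \subset V :\: B0 by rewrite subsetD JV disjoint_sym.
rewrite /sqdegn (big_setID B0) /= (setIidPr B0V) [X in _ <= _ + X](big_setID J) /= (setIidPr sub) addnA.
apply: leq_trans (leq_addr _ _); apply: leq_add.
  by rewrite (eq_bigr (fun=> s ^ 2)) ?sum_nat_const ?cB // => i /dB ->.
rewrite -cJ -sum1_card; apply: leq_sum => i /dJ.
by rewrite expnS expn1 muln_gt0 andbb.
Qed.

End DegreeSquares.

(** * Colex initial segments through binary expansions *)

Section ColexSegment.
Variable N : nat.
Implicit Types (A B : {set 'I_N}).

Definition low m : {set 'I_N} := [set i : 'I_N | i < m].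

Lemma card_low m : m <= N -> #|low m| = m.
Proof.
move=> mN; rewrite /low -sum1dep_card -(big_ord_widen _ (fun=> 1)) //.
by rewrite sum_nat_const card_ord muln1.
Qed.

Lemma low_sub m1 m2 : m1 <= m2 -> low m1 \subset low m2.
Proof. by move=> m12; apply/subsetP => i; rewrite !inE => /leq_trans; apply. Qed.

(** Vertex [i] stands for the natural number [i + 1], so this is half of [colexval] and induces the
    same order ([colexval_emb]). *)
Definition cv A : nat := \sum_(i in A) 2 ^ i.

Lemma cvD1 A i : i \in A -> cv A = 2 ^ i + cv (A :\ i).
Proof. by move=> iA; rewrite /cv (big_setD1 _ iA). Qed.

Lemma cv_ge A i : i \in A -> 2 ^ i <= cv A.
Proof. by move=> /cvD1 ->; apply: leq_addr. Qed.

(** Reads the binary expansion from its top digit: each step decides whether vertex [m] lies in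
    [A]. *)
Lemma low_ind (P : nat -> {set 'I_N} -> Prop) :
  P 0 set0 ->
  (forall m A, A \subset low m -> P m A -> P m.+1 A) ->
  (forall m (i : 'I_N) A, i = m :> nat -> i \in A -> A :\ i \subset low m ->
     P m (A :\ i) -> P m.+1 A) ->
  forall m A, A \subset low m -> P m A.
Proof.
move=> P0 PS PD; elim=> [|m IH] A Am.
  by have -> : A = set0 by apply/eqP; rewrite -subset0; apply: subset_trans Am _;
    apply/subsetP => i; rewrite inE.
have [Am'|/subsetPn[i iA]] := boolP (A \subset low m); first by apply/PS/IH.
rewrite inE -leqNgt => mi.
have im : i = m :> nat.
  by apply/eqP; rewrite eqn_leq mi andbT -ltnS; move/subsetP: Am => /(_ _ iA); rewrite inE.
have sub : A :\ i \subset low m.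
  apply/subsetP => l; rewrite !inE => /andP[li lA].
  move/subsetP: Am => /(_ _ lA); rewrite inE ltnS leq_eqVlt => /orP[/eqP lm|//].
  by move/eqP: li; case; apply/val_inj; rewrite /= lm im.
by apply: PD im iA sub (IH _ sub).
Qed.

Lemma cv_lt m A : A \subset low m -> cv A < 2 ^ m.
Proof.
move: m A; apply: low_ind => [|m A _ h|m i A im iA _ h].
- by rewrite /cv big_set0.
- by apply: leq_trans h _; rewrite leq_exp2l.
- by rewrite (cvD1 iA) im expnS mul2n -addnn ltn_add2l.
Qed.

(** Among sets of a given size, the initial segment has the least [cv]. *)
Lemma cv_card m A : A \subset low m -> 2 ^ #|A| <= (cv A).+1.
Proof.
move: m A; apply: low_ind => [|m A _ h|m i A im iA sA h] //.
  by rewrite cards0 /cv big_set0.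
rewrite (cvD1 iA) im (cardsD1 i) iA expnS mul2n -addnn -addnS leq_add //.
rewrite leq_exp2l // -[X in _ <= X]im.
have iN := ltn_ord i; apply: leq_trans (subset_leq_card sA) _.
by rewrite -im card_low // ltnW.
Qed.

Lemma cv_low A B m : cv B < cv A -> A \subset low m -> B \subset low m.
Proof.
move=> BA Am; apply/subsetP => i iB; rewrite inE.
have := leq_ltn_trans (cv_ge iB) (ltn_trans BA (cv_lt Am)).
by rewrite ltn_exp2l.
Qed.

Lemma sub_low A : A \subset low N.
Proof. by apply/subsetP => i _; rewrite inE. Qed.

Lemma cv_inj : injective cv.
Proof.
suff h m A : A \subset low m -> forall B, B \subset low m -> cv A = cv B -> A = B.
  by move=> A B; apply: (h N); apply: sub_low.
move: m A; apply: low_ind => [B _|m A Am IH B Bm|m i A im iA sA IH B Bm].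
- rewrite /cv big_set0 => /esym/eqP; rewrite sum_nat_eq0 => /forallP h.
  apply/setP => i; rewrite inE; apply/esym/negbTE/negP => iB.
  by have := h i; rewrite iB expn_eq0.
- move=> e; apply: IH => //; have [//|/subsetPn[i iB]] := boolP (B \subset low m).
  rewrite inE -leqNgt => mi; have := cv_lt Am; rewrite e ltnNge.
  by rewrite (leq_trans _ (cv_ge iB)) // leq_exp2l.
- move=> e; have iB : i \in B.
    apply: contraT => iB; have Bm' : B \subset low m.
      apply/subsetP => l lB; move/subsetP: Bm => /(_ _ lB).
      rewrite !inE ltnS leq_eqVlt => /orP[/eqP lm|//].
      by move: iB; rewrite (_ : i = l) ?lB //; apply/val_inj; rewrite /= im lm.
    have := cv_lt Bm'; rewrite -e ltnNge.
    by rewrite (leq_trans _ (cv_ge iA)) // im.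
  rewrite -(setD1K iA) -(setD1K iB); congr (_ |: _); apply: IH.
    apply/subsetP => l; rewrite !inE => /andP[li lB].
    move/subsetP: Bm => /(_ _ lB); rewrite inE ltnS leq_eqVlt => /orP[/eqP lm|//].
    by move/eqP: li; case; apply/val_inj; rewrite /= lm im.
  by move: e; rewrite (cvD1 iA) (cvD1 iB) => /addnI.
Qed.

Definition colex_before n k A : {set {set 'I_N}} :=
  [set B in layer (low n) k | cv B < cv A].

Definition colex_seg n k s : {set {set 'I_N}} :=
  [set A in layer (low n) k | #|colex_before n k A| < s].

Lemma colex_seg_layer n k s A : A \in colex_seg n k s ->
  A \subset low n /\ #|A| = k.
Proof. by rewrite !inE => /andP[/andP[? /eqP ?] _]. Qed.

(** All other members precede the colex-greatest one, which has fewer than [s] predecessors. *)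
Lemma card_colex_seg n k s : #|colex_seg n k s| <= s.
Proof.
have [->|[A0 A0s]] := set_0Vmem (colex_seg n k s); first by rewrite cards0.
case: (@arg_maxnP _ A0 (fun A => A \in colex_seg n k s) cv A0s) => A As Amax.
rewrite (cardsD1 A) As add1n; move: (As); rewrite inE => /andP[_].
apply: leq_trans; rewrite ltnS; apply: subset_leq_card; apply/subsetP => B.
rewrite in_setD1 => /andP[BA Bs]; have [Bn Bk] := colex_seg_layer Bs.
rewrite !inE Bn Bk eqxx /= ltn_neqAle; apply/andP; split; last exact: Amax.
by apply: contra BA => /eqP/cv_inj ->.
Qed.

(** A set with a vertex at or above [m] is preceded by all [k]-subsets of [low m], too many for the
    segment. *)
Lemma colex_seg_low n k s m A : n <= N -> s <= 'C(m, k) ->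
  A \in colex_seg n k s -> A \subset low m.
Proof.
move=> nN sm As; apply: contraT => /subsetPn[i iA]; rewrite inE -leqNgt => mi.
have [An Ak] := colex_seg_layer As.
have im : i < n by move/subsetP: An => /(_ _ iA); rewrite inE.
move: As; rewrite inE => /andP[_]; rewrite ltnNge => /negP; case.
apply: leq_trans sm _; have mN : m <= N by apply: leq_trans mi _; rewrite ltnW.
rewrite -{1}(card_low mN) -card_layer; apply: subset_leq_card; apply/subsetP => B.
rewrite !inE => /andP[Bm ->]; rewrite andbT; apply/andP; split.
  by apply: subset_trans Bm _; apply: low_sub; apply: leq_trans mi (ltnW im).
by apply: leq_trans (cv_lt Bm) (leq_trans _ (cv_ge iA)); rewrite leq_exp2l.
Qed.

(** The witnesses are the last [(k + 2)]-subset of [low k.+3] and the set just after it, [low k.+1]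
    with vertex [k + 3]; they share only the vertices 1 to [k]. *)
Lemma colex_seg_pair n k s : n <= N -> k.+4 <= n -> k.+4 <= s ->
  exists A B, [/\ A \in colex_seg n k.+2 s, B \in colex_seg n k.+2 s & #|A :&: B| <= k].
Proof.
move=> nN kn ks.
have N0 : 0 < N by lia. have N3 : k.+3 < N by lia.
pose o := Ordinal N0; pose q := Ordinal N3.
have small A : A \in layer (low n) k.+2 ->
    (forall B, #|B| = k.+2 -> cv B < cv A -> B \subset low k.+3) ->
    A \in colex_seg n k.+2 s.
  move=> AL hA; rewrite inE AL /=; apply: leq_trans ks; rewrite ltnS.
  have -> : k.+3 = #|layer (low k.+3) k.+2|.
    by rewrite card_layer card_low ?binSn //; lia.
  apply: subset_leq_card; apply/subsetP => B; rewrite !inE => /andP[/andP[_ /eqP cB] h].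
  by rewrite hA //= cB.
pose A := low k.+3 :\ o; pose B := q |: low k.+1.
have qB : q \notin low k.+1 by rewrite inE /=; lia.
have Bq : B :\ q = low k.+1 by rewrite /B setU1K.
exists A, B; split.
- apply: small.
    rewrite inE; apply/andP; split.
      by apply: subset_trans (subsetDl _ _) (low_sub _); lia.
    have := cardsD1 o (low k.+3); rewrite card_low; last by lia.
    by rewrite inE /= add1n => -[<-].
  by move=> B' _ h; apply: cv_low h _; apply: subsetDl.
- apply: small.
    rewrite inE /B cardsU1 qB card_low ?eqxx ?andbT; last by lia.
    by rewrite subUset sub1set inE /= kn low_sub //; lia.
  move=> B' cB' h; apply/subsetP => i iB'; rewrite inE ltnNge; apply/negP => ki.
  have B4 : B \subset low k.+4.
    by rewrite /B subUset sub1set inE /= ltnSn low_sub //; lia.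
  have : B' \subset low k.+4 by apply: cv_low h B4.
  move/subsetP => /(_ _ iB'); rewrite inE => ik.
  have {ki ik} ik : i = k.+3 :> nat by lia.
  (* Once the common top vertex is removed, [B'] would have to precede [low k.+1] with the same
     size, against [cv_card]. *)
  have := h; rewrite (cvD1 iB') (@cvD1 B q) ?setU11 // Bq ik ltn_add2l.
  apply/negP; rewrite -leqNgt -ltnS; apply: leq_trans (cv_card (sub_low _)).
  have := cardsD1 i B'; rewrite iB' cB' add1n => -[<-].
  by apply: cv_lt.
apply: (@leq_trans #|low k.+1 :\ o|).
  apply: subset_leq_card; apply/subsetP => i; rewrite !inE => /andP[/andP[-> ik]].
  by case/orP => // /eqP e; move: ik; rewrite e /= ltnn.
have := cardsD1 o (low k.+1); rewrite card_low; last by lia.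
by rewrite inE /= add1n => -[<-].
Qed.

End ColexSegment.

Arguments low {N} m.
Arguments colex_before {N} n k A.
Arguments colex_seg {N} n k s.

Lemma bin_add_ge m j k : 'C(m, k.+1) + j * 'C(m, k) <= 'C(m + j, k.+1).
Proof.
elim: j => [|j IH]; first by rewrite mul0n !addn0.
rewrite addnS binS mulSn addnCA addnC leq_add //.
by rewrite leq_bin2l // leq_addr.
Qed.

Lemma bin_scale_ge c m l k : c * l <= m -> 0 < l ->
  c * 'C(l.-1, k.+1) <= 'C(m, k.+1).
Proof.
case: c => [|c] // cl l0; rewrite -(leq_pmul2l (ltn0Sn k)) mulnCA -!mul_bin_diag mulnA.
apply: leq_mul; first by apply: leq_trans cl; rewrite leq_mul2l leq_pred orbT.
by apply: leq_bin2l; rewrite mulSn in cl; lia.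
Qed.

(** * Competitors of the colex segment *)

Section Families.
Variables (N n k : nat).
Hypothesis nN : n <= N.
Local Notation V := (@low N n).
Local Notation K := k.+2.
Local Notation seg s := (@colex_seg N n K s).

Lemma uniform_colex_seg s : uniform_family V k (seg s).
Proof. by split=> A /colex_seg_layer[]. Qed.

Lemma low_cardV : #|V| = n. Proof. exact: card_low. Qed.

(** The gain of 2 is absolute; the last bound is what makes it a constant factor when [s] is
    bounded. *)
Lemma exists_family_small s : k.+4 <= s -> k.+2 + s <= n ->
  exists G : {set {set 'I_N}},
   [/\ uniform_family V k G, #|G| = s, sqdegn V (seg s) + 2 <= sqdegn V G &
       sqdegn V (seg s) <= K * s ^ 2].
Proof.
move=> ks sn; have [|A [B [As Bs cAB]]] := @colex_seg_pair N n k s nN _ ks; first lia.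
have h1 := sqdegn_le_nonsunflower (uniform_colex_seg s) (card_colex_seg _ _ _ _) As Bs cAB.
have sub : @low N k.+1 \subset low (k.+1 + s) by apply: low_sub; lia.
have [|||||G [UG cG h2]] := @exists_sunflower _ V (low k.+1) (low (k.+1 + s) :\: low k.+1) k s.
- by apply: low_sub; lia.
- by apply: subset_trans (subsetDl _ _) (low_sub _ _); lia.
- by rewrite card_low //; lia.
- by rewrite cardsD (setIidPr sub) !card_low; lia.
- by rewrite disjoint_sym disjoints_subset setDE subsetIr.
exists G; split=> //; first by apply: leq_trans h2.
by clear -h1 ks; nia.
Qed.

(** Source of the constant [alpha]. If [n < (4K + 1) m], then [n <= (8K + 2) (m - 1 - K)], the 2
    coming from [m <= 2 (m - 1 - K)]; hence ['C(n, K) <= n ^ K] is at most [(8K + 2)^K K!] times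
    ['C(m.-1, K)], which is below [s]. *)
Lemma large_index s m : 4 * K ^ 2 + 2 * K <= m -> 'C(m.-1, K) < s ->
  s * ((8 * K + 2) ^ K * K`!) <= 'C(n, K) -> (4 * K + 1) * m <= n.
Proof.
move=> mK ms sn; rewrite leqNgt; apply/negP => nm.
have m2 : m <= 2 * (m.-1 - K) by nia.
have h1 : n ^ K <= ((8 * K + 2) * (m.-1 - K)) ^ K.
  rewrite leq_exp2r //; nia.
rewrite expnMn in h1.
have h2 := expn_le_bin m.-1 K.
have h3 := leq_trans (bin_le_expn n K) h1.
have p0 : 0 < (8 * K + 2) ^ K * K`! by rewrite muln_gt0 expn_gt0 fact_gt0; lia.
have h4 : 'C(n, K) <= 'C(m.-1, K) * ((8 * K + 2) ^ K * K`!).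
  apply: leq_trans h3 _; rewrite mulnCA leq_mul2l; apply/orP; right.
  by rewrite mulnC.
have : s * ((8 * K + 2) ^ K * K`!) <= 'C(m.-1, K) * ((8 * K + 2) ^ K * K`!).
  exact: leq_trans sn h4.
by rewrite leq_pmul2r // leqNgt ms.
Qed.

(* With [m] least such that [s <= 'C(m, K)], the colex segment lives on [m] vertices and
   has degrees at most ['C(m.-1, k.+1)]; the competitor is any family of [s] sets meeting
   the first [(m - K) %/ (2 * K ^ 2)] vertices. *)
Lemma exists_family_large s : 'C(4 * K ^ 2 + 2 * K, K) < s ->
  s * ((8 * K + 2) ^ K * K`!) <= 'C(n, K) ->
  exists G : {set {set 'I_N}},
   [/\ uniform_family V k G, #|G| = s, 2 * sqdegn V (seg s) <= sqdegn V G &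
       4 * (K * s) ^ 2 <= n * sqdegn V G].
Proof.
move=> s0 sn.
have ex : exists m, s <= 'C(m, K).
  exists n; apply: leq_trans sn; rewrite leq_pmulr // muln_gt0 expn_gt0 fact_gt0; lia.
case: (ex_minnP ex) => m sm mmin.
have mK : 4 * K ^ 2 + 2 * K < m.
  rewrite ltnNge; apply/negP => h; move: s0; rewrite ltnNge => /negP; apply.
  by apply: leq_trans sm _; apply: leq_bin2l.
have ms : 'C(m.-1, K) < s.
  by rewrite ltnNge; apply/negP => /mmin; lia.
have mn := large_index (ltnW mK) ms sn.
have m0 : 0 < m by lia.
pose j := (m - K) %/ (2 * K ^ 2).
have j1 : j * (2 * K ^ 2) <= m - K by apply: leq_trunc_div.
have j2 : m <= 4 * K ^ 2 * j.
  have := ltn_ceil (m - K) (_ : 0 < 2 * K ^ 2); rewrite -/j => /(_ isT) h.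
  have : m - K < 2 * K ^ 2 * j + 2 * K ^ 2 by rewrite mulnS addnC mulnC in h; lia.
  by rewrite -(mulnA 4) -mulnA; lia.
have jm : j <= m by apply: leq_trans (leq_trans j1 (leq_subr _ _)); rewrite leq_pmulr.
have jn : j <= n by nia.
have JV : @low N j \subset V by apply: low_sub.
(* At least [j * 'C(n - j, k.+1)] sets meet [low j]. On the other side [K * s <= m * 'C(m.-1, k.+1)]
   with [m <= 4 K^2 j], and [n - j >= 4 K m] makes up for the factor [4K]. *)
have hs : s + 'C(#|V| - #|@low N j|, K) <= 'C(#|V|, K).
  rewrite low_cardV card_low; last by lia.
  rewrite -{2}(subnK jn); apply: leq_trans (bin_add_ge _ _ _).
  rewrite addnC leq_add2l; apply: leq_trans sm _.
  rewrite -(leq_pmul2l (ltn0Sn k.+1)) -mul_bin_diag.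
  have h : 4 * K * 'C(m.-1, k.+1) <= 'C(n - j, k.+1).
    by apply: bin_scale_ge => //; lia.
  apply: leq_trans (leq_mul j2 (leqnn _)) _.
  rewrite mulnA (_ : 4 * K ^ 2 * j = K * j * (4 * K)); last by lia.
  by rewrite -mulnA leq_mul2l h orbT.
have [G [UG cG hG]] := exists_covered_family JV hs.
rewrite card_low in hG; last by lia.
exists G; split=> //.
- have j0 : 0 < j by case: (j) j2 => //; lia.
  have [segV segK] := uniform_colex_seg s.
  have d i : deg (seg s) i <= 'C(m.-1, k.+1).
    have mN : m <= N by nia.
    rewrite -{1}(card_low mN); apply: deg_le => // A As.
    exact: colex_seg_low As.
  have h := sqdegn_le_max (uniform_colex_seg s) d.
  (* The maximal degree is thus at most [K s / (m - K)], so the segment has at most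
     [K^2 s^2 / (m - K) <= s^2 / (2j)], against [s^2 / j] for [G]. The divisor [2 K^2] in [j] is
     chosen for this. *)
  have e : K * 'C(m.-1, K) = (m - K) * 'C(m.-1, k.+1).
    by rewrite mul_bin_left; congr (_ * _); lia.
  have h2 : j * (2 * K ^ 2) * sqdegn V (seg s) <= K ^ 2 * s ^ 2.
    apply: leq_trans (leq_mul j1 h) _; rewrite mulnA -e.
    rewrite (_ : _ * _ = K ^ 2 * ('C(m.-1, K) * #|seg s|)); last by lia.
    by rewrite leq_mul2l expnS expn1 leq_mul ?orbT ?(ltnW ms) // card_colex_seg.
  rewrite -(leq_pmul2l (_ : 0 < K ^ 2)) // -(leq_pmul2l j0).
  apply: leq_trans (_ : K ^ 2 * s ^ 2 <= _).
    by apply: leq_trans h2; rewrite leq_eqVlt; apply/orP; left; apply/eqP; lia.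
  by rewrite mulnCA leq_mul2l hG orbT.
- rewrite expnMn mulnA; apply: leq_trans (leq_mul (leqnn _) hG) _.
  rewrite mulnA leq_mul //.
  have : j * (2 * K ^ 2) * 2 <= m * 2 by rewrite leq_mul2r (leq_trans j1 (leq_subr _ _)).
  nia.
Qed.

End Families.

Local Open Scope ring_scope.

(** * Comparison of the two graphs *)

Section PairGraph.
Variables (T : finType) (p q : T) (k : nat).
Hypothesis pq : p != q.
Local Notation V := ([set: T] :\ q :\ p).
Implicit Types (H C G : {set {set T}}).

Definition pair_graph H : {set {set T}} :=
  [set A : {set T} | #|A| == k.+4 & (p \in A) && (q \in A) ==> (A :\ q :\ p \in H)].

Lemma wsum_pair_graph (R : realFieldType) H (x : T -> R) : uniform_family V k H ->
  wsum (pair_graph H) x =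
  elsym V k.+4 x + (x p + x q) * elsym V k.+3 x + x p * x q * wsum H x.
Proof.
move=> [HV Hk]; have qp : q != p by rewrite eq_sym.
rewrite {1}/wsum (bigID (fun A : {set T} => q \in A)) /=.
rewrite [X in X + _](bigID (fun A : {set T} => p \in A)) /=.
rewrite [X in _ + X](bigID (fun A : {set T} => p \in A)) /=.
have -> : \sum_(A | (A \in pair_graph H) && (q \in A) && (p \in A)) \prod_(i in A) x i =
    x p * x q * wsum H x.
  rewrite /wsum mulr_sumr (reindex_onto (fun A => q |: (p |: A)) (fun A => A :\ q :\ p)) /=; last first.
    by move=> A /andP[/andP[_ qA] pA]; rewrite (setD1K (a := p)) ?inE ?pA ?pq // setD1K.
  have back (A : {set T}) : A \subset V -> (q |: (p |: A)) :\ q :\ p = A.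
    move=> /subsetP AV; apply/setP => i; rewrite !inE.
    have [->|ip] := eqVneq i p; first by apply/esym/negbTE/negP => /AV; rewrite !inE eqxx.
    have [->|iq] //= := eqVneq i q.
    by apply/esym/negbTE/negP => /AV; rewrite !inE eqxx andbF.
  have cardE (A : {set T}) : A \subset V -> #|q |: (p |: A)| = #|A|.+2.
    move=> /subsetP AV; have pA : p \notin A by apply/negP => /AV; rewrite !inE eqxx.
    have qA : q \notin A by apply/negP => /AV; rewrite !inE eqxx andbF.
    by rewrite !cardsU1 !inE (negPf qp) qA pA.
  apply: eq_big => [A|A].
    rewrite !inE !eqxx !orbT /= !andbT.
    apply/idP/idP => [/andP[/andP[_ h] /eqP e]|AH]; first by rewrite -e.
    by rewrite back ?HV // cardE ?HV // Hk // AH !eqxx.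
  rewrite !inE !eqxx !orbT /= !andbT => /andP[/andP[_ h] /eqP e].
  rewrite e in h; have /subsetP AV := HV _ h.
  have pA : p \notin A by apply/negP => /AV; rewrite !inE eqxx.
  have qA : q \notin A by apply/negP => /AV; rewrite !inE eqxx andbF.
  rewrite big_setU1 ?inE ?(negPf qp) // big_setU1 //=; ring.
have -> : \sum_(A | (A \in pair_graph H) && (q \in A) && (p \notin A)) \prod_(i in A) x i =
    x q * elsym V k.+3 x.
  have <- : [set: T] :\ p :\ q = V by rewrite !setDDl setUC.
  rewrite -elsym_in ?inE ?qp //; apply: eq_bigl => A.
  rewrite !inE subsetD1 subsetT /=.
  by case: (p \in A); case: (q \in A); rewrite ?andbF ?andbT.
have -> : \sum_(A | (A \in pair_graph H) && (q \notin A) && (p \in A)) \prod_(i in A) x i =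
    x p * elsym V k.+3 x.
  rewrite -elsym_in ?inE ?pq //; apply: eq_bigl => A.
  rewrite !inE subsetD1 subsetT /=.
  by case: (p \in A); case: (q \in A); rewrite ?andbF ?andbT.
have -> : \sum_(A | (A \in pair_graph H) && (q \notin A) && (p \notin A)) \prod_(i in A) x i =
    elsym V k.+4 x.
  rewrite -elsym_notin; apply: eq_bigl => A.
  rewrite !inE subsetD1 subsetT /=.
  by case: (p \in A); case: (q \in A); rewrite ?andbF ?andbT.
ring.
Qed.

Lemma card_pair_V : #|V| = (#|T| - 2)%N.
Proof.
have := cardsD1 q [set: T]; have := cardsD1 p ([set: T] :\ q).
by rewrite !inE pq cardsT /=; lia.
Qed.

Lemma card_pair_graph H : uniform_family V k H ->
  #|pair_graph H| = ('C(#|T| - 2, k.+4) + 2 * 'C(#|T| - 2, k.+3) + #|H|)%N.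
Proof.
(* Evaluating the weight identity at the all-ones point counts the edges. *)
move=> UH; have := wsum_pair_graph (fun=> 1 : rat) UH; have [HV Hk] := UH.
rewrite (@wsum_const _ _ _ k.+4); last by move=> A; rewrite inE => /andP[/eqP].
rewrite (wsum_const _ Hk) !elsym_const !expr1n /= !mulr1 mul1r card_pair_V -[1 + 1]/(2%:R).
by rewrite -natrM -!natrD => /eqP; rewrite eqr_nat => /eqP.
Qed.

Lemma pair_graph_sub_layer H : pair_graph H \subset layer [set: T] k.+4.
Proof. by apply/subsetP => A; rewrite !inE subsetT => /andP[]. Qed.

End PairGraph.

Lemma bin_pascal2 n k : 'C(n.+2, k.+2) = ('C(n, k.+2) + 2 * 'C(n, k.+1) + 'C(n, k))%N.
Proof. by rewrite !binS; lia. Qed.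

Lemma heavy_gap_arith (R : realFieldType) (w e b b' d g g' t2 : R) :
  w <= e -> 2 * t2 <= d -> b' <= t2 -> 0 <= g' -> e <= b + b' - d -> w + t2 <= b + g'.
Proof. lra. Qed.

(** * Large and very small weights on the two last vertices *)

Section GapLemmas.
Variables (R : realFieldType) (T : finType) (p q : T) (k n : nat).
Hypotheses (pq : p != q) (cT : #|T| = n.+2).
Local Notation V := ([set: T] :\ q :\ p).
Local Notation K := k.+2.
Implicit Types (H C G : {set {set T}}) (x y : T -> R).

Lemma cardVn : #|V| = n. Proof. by rewrite card_pair_V // cT; lia. Qed.

Definition prob x := (forall i, 0 <= x i) /\ \sum_i x i = 1.

Lemma sum_pair x : \sum_i x i = \sum_(i in V) x i + (x p + x q).
Proof.
rewrite (bigD1 q) //= (bigD1 p) //= (eq_bigl (fun i => i \in V)); first by ring.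
by move=> i; rewrite !inE andbT andbC.
Qed.

(** A lower bound, free of [n], for the constant of [elsym_deficit]: if [(m - K) u >= 1/4], then
    ['C(m, K) u^K >= ((m - K) u)^K / K!]. *)
Definition kap : R := (4 ^+ K * K`!%:R * (k.+4 * k.+3)%:R)^-1.

Lemma kap_gt0 : 0 < kap.
Proof. by rewrite invr_gt0 -natrX -!natrM ltr0n muln_gt0 muln_gt0 expn_gt0 fact_gt0. Qed.

Lemma kap_le1 : kap <= 1.
Proof.
rewrite invf_le1; last by rewrite -invr_gt0 kap_gt0.
by rewrite -natrX -!natrM ler1n muln_gt0 muln_gt0 expn_gt0 fact_gt0.
Qed.

Lemma kap_le m (u : R) : 1 <= 4 * (m - K)%:R * u ->
  kap <= 'C(m, K)%:R * u ^+ K / (k.+4 * k.+3)%:R.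
Proof.
move=> h; rewrite /kap invfM ler_pM2r ?invr_gt0 ?ltr0n //.
rewrite -[leLHS]mul1r ler_pdivrMr; last first.
  by rewrite -natrX -natrM ltr0n muln_gt0 expn_gt0 fact_gt0.
have h1 : 1 <= (4 * (m - K)%:R * u) ^+ K by apply: exprn_ege1.
apply: le_trans h1 _; rewrite !exprMn.
have u0 : 0 <= u.
  have m0 : 0 <= 4 * (m - K)%:R :> R by rewrite mulr_ge0.
  have [//|u0] := leP 0 u.
  by have := le_trans h (mulr_ge0_le0 m0 (ltW u0)); rewrite ler10.
have h2 := expn_le_bin m K.
have h3 : (m - K)%:R ^+ K <= K`!%:R * 'C(m, K)%:R :> R by rewrite -natrX -natrM ler_nat.
rewrite (_ : 'C(m, K)%:R * u ^+ K * (4 ^+ K * K`!%:R) =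
  4 ^+ K * (K`!%:R * 'C(m, K)%:R) * u ^+ K); last by ring.
by rewrite ler_wpM2r ?exprn_ge0 // ler_wpM2l ?exprn_ge0.
Qed.

(** Even the complete graph loses [2 / t^2] at such an [x], by [elsym_deficit], whereas at the
    uniform point all sets containing both [p] and [q] weigh at most [1 / t^2]. *)
Lemma heavy_gap C G x (L : R) : uniform_family V k C -> uniform_family V k G ->
  prob x -> (2 * K <= n)%N -> 1 <= L -> 2 <= kap * (L - 1) ^+ 2 ->
  (L / n.+2%:R <= x p) || (L / n.+2%:R <= x q) ->
  wsum (pair_graph p q k C) x + n.+2%:R ^- 2 <=
  wsum (pair_graph p q k G) (fun=> n.+2%:R^-1).
Proof.
move=> UC UG [x0 sx] nK L1 kL hpq; set t : R := n.+2%:R.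
have t0 : 0 < t by rewrite ltr0n.
have h1 : wsum (pair_graph p q k C) x <= elsym [set: T] k.+4 x.
  by apply: wsum_sub => //; apply: pair_graph_sub_layer.
have cTT : #|[set: T]| = n.+2 by rewrite cardsT.
have sxT : \sum_(i in [set: T]) x i = #|[set: T]|%:R * t^-1.
  by rewrite cTT divff ?gt_eqF // -sx; apply: eq_bigl => i; rewrite inE.
have c0 : (0 < #|[set: T]|)%N by rewrite cTT.
have ti0 : 0 <= t^-1 by rewrite invr_ge0 ltW.
have := elsym_deficit K x0 c0 sxT ti0; rewrite cTT.
rewrite subn2 /=.
have kapn : kap <= 'C(n, K)%:R * t^-1 ^+ K / (k.+4 * k.+3)%:R.
  apply: kap_le; rewrite ler_pdivlMr // mul1r /t -natrM ler_nat.
  by clear -nK; lia.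
have D0 := sqdist_ge0 [set: T] t^-1 x.
have hD : (L - 1) ^+ 2 * t ^- 2 <= sqdist [set: T] t^-1 x.
  have [i hi] : exists i, L / t <= x i by case/orP: hpq => h; eexists; exact: h.
  apply: le_trans (@sqdist_ge _ _ _ _ _ i _); last by rewrite inE.
  rewrite -exprVn -exprMn lerXn2r ?nnegrE ?mulr_ge0 ?subr_ge0 //.
    by apply: le_trans hi; rewrite ler_peMl.
  by rewrite mulrBl mul1r lerD2r.
move=> h2; have h3 : 2 * t ^- 2 <= 'C(n, K)%:R * t^-1 ^+ K / (k.+4 * k.+3)%:R * sqdist [set: T] t^-1 x.
  apply: le_trans (_ : kap * sqdist [set: T] t^-1 x <= _); last by rewrite ler_wpM2r.
  apply: le_trans (ler_wpM2l (ltW kap_gt0) hD); rewrite mulrA ler_wpM2r //.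
  by rewrite invr_ge0 exprn_ge0 // ltW.
have UGk A : A \in pair_graph p q k G -> #|A| = k.+4.
  by rewrite inE => /andP[/eqP].
rewrite (wsum_const _ UGk) card_pair_graph // cT subn2 /=.
have h4 : 'C(n, K)%:R * t^-1 ^+ k.+4 <= t ^- 2.
  have -> : t^-1 ^+ k.+4 = t^-1 ^+ K * t^-1 ^+ 2 by rewrite -exprD addn2.
  rewrite mulrA -exprVn ler_piMl ?exprn_ge0 //.
  apply: (@bin_expr_le1 _ n.+2) => //; first by rewrite leqW.
  by rewrite divff // gt_eqF.
have h5 : 0 <= #|G|%:R * t^-1 ^+ k.+4 by rewrite mulr_ge0 ?exprn_ge0.
move: h2; rewrite bin_pascal2 !natrD !mulrDl.
by apply: heavy_gap_arith h1 h3 h4 h5.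
Qed.

End GapLemmas.

Lemma light_gap_arith (R : realFieldType) (w e b b' f d : R) :
  w <= e + 2 * b -> e <= f -> f <= b' - d -> w + d <= b' + 2 * b.
Proof. lra. Qed.

Section LightGap.
Variables (R : realFieldType) (T : finType) (p q : T) (k n : nat).
Hypotheses (pq : p != q) (cT : #|T| = n.+2) (n0 : (0 < n)%N).
Local Notation V := ([set: T] :\ q :\ p).
Local Notation K := k.+2.
Implicit Types (C G : {set {set T}}) (x y : T -> R).

Definition light_point (i : T) : R := if i == q then 0 else n.+1%:R^-1.

(** The constant of [elsym_deficit] on [n + 1] vertices, times the squared deviation of a single
    vertex of weight 0. *)
Definition light_gap : R :=
  'C(n - 1, K)%:R * n.+1%:R^-1 ^+ K / (k.+4 * k.+3)%:R * n.+1%:R^-1 ^+ 2.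

Lemma prob_light_point : prob light_point.
Proof.
split=> [i|]; first by rewrite /light_point; case: ifP; rewrite // invr_ge0.
rewrite (bigD1 q) //= {1}/light_point eqxx add0r (eq_bigr (fun=> n.+1%:R^-1)).
  by rewrite sumr_const -[LHS]mulr_natr (cardC1 q) cT mulVf ?pnatr_eq0.
by move=> i /negPf iq; rewrite /light_point iq.
Qed.

Lemma light_gap_gt0 : (K < n)%N -> 0 < light_gap.
Proof.
move=> Kn; rewrite /light_gap; apply: mulr_gt0; last by rewrite exprn_gt0 ?invr_gt0.
apply: divr_gt0; last by rewrite ltr0n.
apply: mulr_gt0; last by rewrite exprn_gt0 ?invr_gt0.
by rewrite ltr0n bin_gt0; clear -Kn; lia.
Qed.

(** Up to [2 (x p + x q)] the weight sits on [n] vertices. Giving [p] a full share then gains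
    [light_gap], whatever the families, because no edge through both [p] and [q] contributes when
    [q] has weight 0. *)
Lemma light_gap_le C G x : uniform_family V k C -> uniform_family V k G -> prob x ->
  wsum (pair_graph p q k C) x + light_gap <=
  wsum (pair_graph p q k G) light_point + 2 * (x p + x q).
Proof.
move=> UC UG [x0 sx]; have [CV Ck] := UC.
have cV : #|V| = n := cardVn pq cT.
have nR : 0 < n%:R :> R by rewrite ltr0n.
have sV := sum_pair pq x; rewrite sx in sV.
have S0 : 0 <= \sum_(i in V) x i by apply: sumr_ge0.
have S1 : \sum_(i in V) x i <= 1 by rewrite sV lerDl addr_ge0.
have xi1 i : x i <= 1.
  by rewrite -sx (bigD1 i) //= lerDl sumr_ge0.
have small j : elsym V j x <= 1.
  by apply: le_trans (elsym_le_expr _ _ x0) _; apply: exprn_ile1.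
have h1 : wsum (pair_graph p q k C) x <= elsym V k.+4 x + 2 * (x p + x q).
  rewrite wsum_pair_graph // -addrA lerD2l (_ : 2 * _ = (x p + x q) + (x p + x q)); last by ring.
  apply: lerD; first by rewrite ler_piMr ?addr_ge0.
  apply: (@le_trans _ _ (x p * x q)).
    rewrite ler_piMr ?mulr_ge0 //; apply: le_trans (small K); apply: wsum_sub => //.
    by apply/subsetP => A AC; rewrite inE CV // Ck // eqxx.
  by apply: (@le_trans _ _ (x p)); [rewrite ler_piMr | rewrite lerDl].
pose u := (\sum_(i in V) x i) / n%:R.
have u0 : 0 <= u by rewrite divr_ge0.
have h2 : elsym V k.+4 x <= 'C(n, k.+4)%:R * n%:R^-1 ^+ k.+4.
  have su : \sum_(i in V) x i = #|V|%:R * u by rewrite cV mulrC divfK // gt_eqF.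
  have cV0 : (0 < #|V|)%N by rewrite cV.
  apply: le_trans (elsym_maclaurin k.+4 x0 cV0 su u0) _; rewrite cV ler_wpM2l //.
  by apply: lerXn2r; rewrite ?nnegrE ?invr_ge0 ?(ltW nR) // /u ler_pdivrMr // mulVf // gt_eqF.
pose v : R := n.+1%:R^-1.
have v0 : 0 <= v by rewrite invr_ge0.
(* The optimum on [n] vertices, viewed as a non-uniform point on the [n + 1] vertices of [V1]. *)
pose z (i : T) : R := if i == p then 0 else n%:R^-1.
have z0 i : 0 <= z i by rewrite /z; case: ifP; rewrite // invr_ge0.
have zV i : i \in V -> z i = n%:R^-1 by rewrite /z !inE => /andP[/negPf -> _].
pose V1 := [set: T] :\ q.
have pV1 : p \in V1 by rewrite !inE pq.
have cV1 : #|V1| = n.+1 by rewrite (cardsD1 p) pV1 cV.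
have ez : elsym V1 k.+4 z = 'C(n, k.+4)%:R * n%:R^-1 ^+ k.+4.
  rewrite (elsymS _ _ pV1) {2}/z eqxx mul0r addr0 (eq_elsym _ zV).
  by rewrite elsym_const cV.
have sz : \sum_(i in V1) z i = #|V1|%:R * v.
  rewrite cV1 divff ?pnatr_eq0 // (big_setD1 _ pV1) /= {1}/z eqxx add0r (eq_bigr _ zV).
  by rewrite sumr_const cV -[LHS]mulr_natr mulVf // gt_eqF.
have cV10 : (0 < #|V1|)%N by rewrite cV1.
have h3 := elsym_deficit K z0 cV10 sz v0.
rewrite ez cV1 (_ : (n.+1 - 2)%N = (n - 1)%N) // in h3.
have h4 : light_gap <= 'C(n - 1, K)%:R * v ^+ K / (k.+4 * k.+3)%:R * sqdist V1 v z.
  apply: ler_wpM2l; first by apply: divr_ge0 => //; apply: mulr_ge0 => //; apply: exprn_ge0.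
  by have := sqdist_ge v z pV1; rewrite {1}/z eqxx sub0r sqrrN.
have yV i : i \in V -> light_point i = v.
  by rewrite /light_point !inE => /andP[_ /andP[/negPf -> _]].
have e5 : wsum (pair_graph p q k G) light_point = 'C(n.+1, k.+4)%:R * v ^+ k.+4.
  rewrite wsum_pair_graph // !(eq_elsym _ yV) !elsym_const cV.
  rewrite /light_point eqxx (negPf pq) mulr0 mul0r !addr0 -/v binS natrD mulrDl.
  by rewrite [v ^+ k.+4]exprS; ring.
rewrite e5; apply: light_gap_arith h1 h2 _; apply: le_trans h3 _.
by rewrite lerD2l lerN2.
Qed.

End LightGap.

Lemma eventually_ge (R : realType) (z : R) :
  exists N, forall n, (N <= n)%N -> z <= n%:R.
Proof.
exists (Num.truncn z).+1 => n zn; apply: le_trans (ltW (truncnS_gt z)) _.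
by rewrite ler_nat.
Qed.

Lemma sqdegE (R : rcfType) (T : finType) (V : {set T}) (H : {set {set T}}) :
  sqdeg R V H = (sqdegn V H)%:R.
Proof. by rewrite natr_sum; apply: eq_bigr => i _; rewrite natrX. Qed.

Section Existence.
Variable k : nat.
Local Notation K := k.+2.
Local Notation s0 := ('C(4 * K ^ 2 + 2 * K, K)).

Lemma variance_ratio_small (R : realFieldType) (P Q v B : R) : 0 <= P -> P <= B -> 0 < B ->
  P + 2 <= Q -> v <= 1 -> (1 + B^-1) * P <= Q - v /\ 0 < Q - v.
Proof.
move=> P0 PB B0 PQ v1; have : B^-1 * P <= 1 by rewrite mulrC ler_pdivrMr ?mul1r.
by rewrite mulrDl mul1r; split; lra.
Qed.

Lemma variance_ratio_large (R : realFieldType) (P Q v e : R) : 0 <= P -> e <= 1/2 ->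
  2 * P <= Q -> 4 * v <= Q -> 0 < Q -> (1 + e) * P <= Q - v /\ 0 < Q - v.
Proof. by move=> P0 e0 PQ vQ Q0; split; nra. Qed.

(** The bound [(K s0)^2 <= n] keeps the mean term [(K s)^2 / n] at most 1 when [s <= s0], which
    leaves 1 of the excess 2. For larger [s] the ratio 2 and a mean term of at most a quarter leave
    a factor 3/2. *)
Lemma exists_family (R : rcfType) N n s : (n <= N)%N -> ((K * s0) ^ 2 <= n)%N ->
  (k.+4 <= s)%N -> (s * ((8 * K + 2) ^ K * K`!) <= 'C(n, K))%N ->
  exists G : {set {set 'I_N}},
   [/\ uniform_family (@low N n) k G, #|G| = s,
    (1 + (K * s0 ^ 2)%:R^-1) * sqdeg R (@low N n) (colex_seg n K s) <= deg_variance R (@low N n) k G &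
    0 < deg_variance R (@low N n) k G].
Proof.
move=> nN ns ks sn.
have s0p : (0 < s0)%N by rewrite bin_gt0; clear; nia.
have n0 : (0 < n)%N by apply: leq_trans ns; rewrite expn_gt0 muln_gt0 s0p.
have n0R : 0 < n%:R :> R by rewrite ltr0n.
have K2 : (2 <= K * s0 ^ 2)%N.
  by apply: (@leq_mul 2 1); rewrite // expn_gt0 s0p.
have [ss|ss] := leqP s s0.
  have [|G [UG cG h1 h2]] := exists_family_small nN ks _.
    apply: leq_trans ns; move: ss s0p; clear; move: s0 => z sz z0; nia.
  exists G; rewrite /deg_variance !sqdegE cG (card_low nN); split=> //;
    [apply: (proj1 (variance_ratio_small _ _ _ _ _)) | apply: (proj2 (@variance_ratio_small _ (sqdegn (@low N n) (colex_seg n K s))%:R _ _ (K * s0 ^ 2)%:R _ _ _ _ _))];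
    rewrite ?ler0n ?ltr0n //; try (by apply: leq_trans K2);
    try (by rewrite ler_nat (leq_trans h2) // leq_mul2l leq_exp2r // ss orbT);
    try (by rewrite -natrD ler_nat);
    rewrite ler_pdivrMr // mul1r -natrM -natrX ler_nat; apply: leq_trans ns;
    by rewrite leq_exp2r // leq_mul2l ss orbT.
have [G [UG cG h1 h2]] := exists_family_large nN ss sn.
have e2 : (K * s0 ^ 2)%:R^-1 <= 1/2 :> R.
  by rewrite div1r lef_pV2 ?posrE ?ltr0n ?ler_nat //; apply: leq_trans K2.
have Q0 : (0 < sqdegn (@low N n) G)%N.
  rewrite lt0n; apply/eqP => e; move: h2; rewrite e muln0 leqn0 muln_eq0 /= expn_eq0 muln_eq0 /=.
  by rewrite andbT; move: ks; clear; case: s.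
have hv : 4 * ((K%:R * s%:R) ^+ 2 / n%:R) <= (sqdegn (@low N n) G)%:R :> R.
  by rewrite mulrA ler_pdivrMr // -natrM -natrX -!natrM ler_nat [X in (_ <= X)%N]mulnC.
have [] := @variance_ratio_large R (sqdegn (@low N n) (colex_seg n K s))%:R _ _ _ _ e2 _ hv _.
- by [].
- by rewrite -natrM ler_nat.
- by rewrite ltr0n.
by move=> r1 r2; exists G; rewrite /deg_variance !sqdegE cG (card_low nN).
Qed.

End Existence.

Lemma half_ratio (R : realFieldType) (a N : R) : 0 < N -> a <= 1/4 ->
  (2 * N)^-1 <= (1 - 2 * a) / N.
Proof.
by move=> N0 a4; rewrite invfM ler_pM2r ?invr_gt0 // -div1r; lra.
Qed.

Lemma amgm2 (R : realFieldType) (a b : R) : a * b <= ((a + b) / 2) ^+ 2.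
Proof.
by rewrite -subr_ge0 (_ : _ - _ = ((a - b) / 2) ^+ 2) ?sqr_ge0 //; field.
Qed.

Lemma mean_bounds (R : realFieldType) (a b c : R) : a < c -> b < c -> (a + b) / 2 <= c.
Proof. lra. Qed.

Section Main.
Variables (R : realType) (k n : nat).
Local Notation K := k.+2.
Local Notation T := 'I_n.+2.

Definition vp : T := inord n.
Definition vq : T := ord_max.

Lemma vp_neq_vq : vp != vq.
Proof. by rewrite -val_eqE /= inordK // neq_ltn ltnSn. Qed.

Lemma lowE : [set: T] :\ vq :\ vp = low n.
Proof.
apply/setP => i; rewrite !inE -!val_eqE /= inordK // andbT.
by have := ltn_ord i; clear; lia.
Qed.

(** Joins the three ranges of the weights of [vp] and [vq]; [gam] is chosen before [x], so the gap
    survives the supremum. *)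
Lemma pair_gap (C G : {set {set T}}) (eps L : R) :
  uniform_family (@low n.+2 n) k C -> uniform_family (@low n.+2 n) k G -> (#|C| <= #|G|)%N ->
  0 < eps <= 1 -> (1 + eps) * sqdeg R (@low n.+2 n) C <= deg_variance R (@low n.+2 n) k G ->
  0 < deg_variance R (@low n.+2 n) k G ->
  1 <= L -> 2 <= kap R k * (L - 1) ^+ 2 ->
  (2 * K.+2 <= n)%N -> 4 * L <= n%:R ->
  4 * L ^+ 4 <= kap R k ^+ 2 * n%:R -> 2 * err R k * L ^+ 2 <= kap R k * n%:R ->
  L ^+ 2 <= kap R k * n%:R -> err R k * (1 + L ^+ 2) / n%:R <= eps / 8 * kap R k ->
  exists2 gam : R, 0 < gam & forall x : T -> R, prob x ->
    exists2 y : T -> R, prob y &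
      wsum (pair_graph vp vq k C) x + gam <= wsum (pair_graph vp vq k G) y.
Proof.
move=> UC UG CG eps01 QP Q0 L1 kL nK n4 n1 n2 n3 n5.
have cT : #|T| = n.+2 by rewrite card_ord.
have n0 : (0 < n)%N by apply: leq_trans nK.
have n0R : 0 < n%:R :> R by rewrite ltr0n.
have UC' := UC; have UG' := UG; rewrite -lowE in UC' UG'.
have cV : #|@low n.+2 n| = n by rewrite card_low // ltnW.
have t0 : 0 < n.+2%:R :> R by rewrite ltr0n.
have lg0 : 0 < light_gap R k n.
  by apply: light_gap_gt0; clear -nK; lia.
set lg := light_gap R k n in lg0.
(* Below [amin] the loss [2 (x vp + x vq) = 4 a] is at most [lg / 2]. Above it, [a] is bounded away
   from 0, and so is the gain of the middle range. *)
pose amin := lg / 8.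
have amin0 : 0 < amin by rewrite divr_gt0.
pose pmin := amin ^+ 2 * (2 * n%:R)^-1 ^+ k.+1.
have n20 : 0 < (2 * n%:R)^-1 :> R by rewrite invr_gt0 mulr_gt0.
have pmin0 : 0 < pmin by rewrite mulr_gt0 ?exprn_gt0.
have [eps0 eps1] := andP eps01.
pose g3 := pmin ^+ 2 * deg_variance R (@low n.+2 n) k G * eps / 16.
have g30 : 0 < g3.
  by rewrite divr_gt0 // mulr_gt0 // mulr_gt0 // exprn_gt0.
exists (Num.min (n.+2%:R ^- 2) (Num.min (lg / 2) g3)).
  by rewrite !lt_min invr_gt0 exprn_gt0 //= divr_gt0.
move=> x px; have [x0 sx] := px.
have [hv|] := boolP ((L / n.+2%:R <= x vp) || (L / n.+2%:R <= x vq)).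
  exists (fun=> n.+2%:R^-1).
    split=> [i|]; first by rewrite invr_ge0.
    by rewrite sumr_const cT -[LHS]mulr_natr mulVf // gt_eqF.
  apply: le_trans (heavy_gap vp_neq_vq cT UC' UG' px _ L1 kL hv).
    by rewrite lerD2l ge_min lexx.
  by clear -nK; lia.
rewrite negb_or -!ltNge => /andP[hp hq].
pose a := (x vp + x vq) / 2.
have a2 : x vp + x vq = 2 * a by rewrite /a mulrC divfK ?pnatr_eq0.
have a0 : 0 <= a by rewrite divr_ge0 ?addr_ge0.
have [alow|ahigh] := ltP a amin.
  exists (light_point R vq n); first exact: prob_light_point.
  have := light_gap_le vp_neq_vq cT n0 UC' UG' px; rewrite a2 => h.
  apply: (@le_trans _ _ (wsum (pair_graph vp vq k C) x + lg / 2)).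
    by rewrite lerD2l !ge_min lexx orbT.
  by move: h alow; rewrite -/lg /amin; clear; lra.
have aL : a <= L / n.+2%:R by apply: mean_bounds.
have aLn : a * n%:R <= L.
  rewrite ler_pdivlMr // in aL; apply: le_trans aL; rewrite ler_wpM2l // ler_nat.
  by rewrite ltnW.
have a4 : a <= 1/4.
  rewrite -(ler_pM2r n0R); apply: le_trans aLn _; move: n4; clear; lra.
pose u := (1 - 2 * a) / n%:R.
have ulow : (2 * n%:R)^-1 <= u by apply: half_ratio.
have u0 : 0 <= u by apply: le_trans ulow; rewrite ltW.
have nu : #|@low n.+2 n|%:R * u = 1 - 2 * a by rewrite cV mulrC divfK // gt_eqF.
have sxV : \sum_(i in low n) x i = #|@low n.+2 n|%:R * u.
  have e := sum_pair vp_neq_vq x; rewrite lowE sx a2 in e.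
  by rewrite nu [X in _ = X - _]e addrK.
have cV0 : (0 < #|@low n.+2 n|)%N by rewrite cV.
have kapn : kap R k <= 'C(#|@low n.+2 n| - 2, K)%:R * u ^+ K / (k.+4 * k.+3)%:R.
  rewrite cV; apply: kap_le.
  have nn : (n <= 2 * (n - 2 - K))%N by clear -nK; lia.
  apply: (@le_trans _ _ (4 * (n - 2 - K)%:R * (2 * n%:R)^-1)).
    rewrite ler_pdivlMr ?mulr_gt0 // mul1r -!natrM ler_nat; clear -nn; lia.
  by rewrite ler_wpM2l // mulr_ge0.
have [y [y0 sy hy]] := @pair_value_compare R T (@low n.+2 n) k a u L (kap R k) cV0 u0 nu a0 a4
  (eq_ind_r (fun m => a * m%:R <= L) aLn cV) (kap_gt0 R k) kapn
  (eq_ind_r (fun m => 4 * L ^+ 4 <= kap R k ^+ 2 * m%:R) n1 cV)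
  (eq_ind_r (fun m => 2 * err R k * L ^+ 2 <= kap R k * m%:R) n2 cV)
  (eq_ind_r (fun m => L ^+ 2 <= kap R k * m%:R) n3 cV)
  C G x eps UC UG CG eps01 QP
  (eq_ind_r (fun m => err R k * (1 + L ^+ 2) / m%:R <= eps / 8 * kap R k) n5 cV) x0 sxV.
pose y' (i : T) := if (i == vp) || (i == vq) then a else y i.
have y'V i : i \in low n -> y' i = y i.
  by rewrite -lowE /y' !inE => /andP[/negPf -> /andP[/negPf -> _]].
have y'p : y' vp = a by rewrite /y' eqxx.
have y'q : y' vq = a by rewrite /y' eqxx orbT.
exists y'.
  split=> [i|]; first by rewrite /y'; case: ifP.
  rewrite (sum_pair vp_neq_vq) lowE (eq_bigr _ y'V) sy nu y'p y'q; move: (a); clear; move=> a; ring.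
have -> : wsum (pair_graph vp vq k G) y' = pair_value (@low n.+2 n) k G a y.
  rewrite wsum_pair_graph ?vp_neq_vq // lowE y'p y'q /pair_value !(eq_elsym _ y'V).
  by rewrite (eq_wsum (proj1 UG) y'V); move: (elsym _ _ _) (elsym _ _ _) (wsum _ _) (a); clear => *; ring.
apply: le_trans hy; apply: lerD.
  (* Replacing both weights by their mean keeps the sum and does not decrease the product. *)
  rewrite wsum_pair_graph ?vp_neq_vq // lowE a2 /pair_value lerD2l ler_wpM2r ?wsum_ge0 //.
  exact: amgm2.
apply: (@le_trans _ _ g3); first by rewrite !ge_min lexx !orbT.
apply: ler_wpM2r; first by rewrite invr_ge0.
apply: ler_wpM2r; first exact: ltW.
apply: ler_wpM2r; first exact: ltW.
have pm : pmin <= a ^+ 2 * u ^+ k.+1.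
  apply: ler_pM; rewrite ?exprn_ge0 ?(ltW n20) ?(ltW amin0) //.
    by rewrite lerXn2r ?nnegrE // ltW.
  by rewrite lerXn2r ?nnegrE // ltW.
by rewrite lerXn2r ?nnegrE ?(ltW pmin0) // (le_trans (ltW pmin0)).
Qed.

End Main.

Lemma scale_bound (R : realFieldType) (c : R) : 0 < c -> c <= 1 ->
  2 <= c * (1 + 2 / c - 1) ^+ 2.
Proof.
move=> c0 c1; rewrite (_ : c * _ = 4 / c); last by field; rewrite gt_eqF.
by rewrite ler_pdivlMr //; lra.
Qed.

Lemma exists_better (R : realType) k :
  exists (alpha : R) (n0 : nat), 0 < alpha /\ forall n s, (n0 <= n)%N ->
    (k.+4 <= s)%N -> s%:R <= alpha * 'C(n, k.+2)%:R ->
    (s <= 'C(n, k.+2))%N /\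
    exists G : {set {set 'I_n.+2}},
    [/\ uniform_family (@low n.+2 n) k G, #|G| = s &
    exists2 gam : R, 0 < gam & forall x : 'I_n.+2 -> R, prob x ->
      exists2 y : 'I_n.+2 -> R, prob y &
      wsum (pair_graph (vp n) (vq n) k (colex_seg n k.+2 s)) x + gam <=
      wsum (pair_graph (vp n) (vq n) k G) y].
Proof.
pose K := k.+2; pose D := ((8 * K + 2) ^ K * K`!)%N.
pose s0 := 'C(4 * K ^ 2 + 2 * K, K).
have D0 : (0 < D)%N by rewrite muln_gt0 expn_gt0 fact_gt0 addn2.
have s0p : (0 < s0)%N by rewrite bin_gt0 /K; clear; nia.
have ka0 := kap_gt0 R k; have ka1 := kap_le1 R k; set ka := kap R k in ka0 ka1.
(* [L] and [eps] depend only on [k], so every remaining condition is a lower bound on [n]. *)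
pose L : R := 1 + 2 / ka.
have L1 : 1 <= L by rewrite lerDl divr_ge0 // ltW.
have kL : 2 <= ka * (L - 1) ^+ 2.
  exact: scale_bound.
pose eps : R := (K * s0 ^ 2)%:R^-1.
have sK : (0 < K * s0 ^ 2)%N by rewrite muln_gt0 expn_gt0 s0p.
have eps0 : 0 < eps by rewrite invr_gt0 ltr0n.
have eps01 : 0 < eps <= 1 by rewrite eps0 invf_le1 ?ltr0n // ler1n.
have [N1 h1] := eventually_ge (4 * L).
have [N2 h2] := eventually_ge (4 * L ^+ 4 / ka ^+ 2).
have [N3 h3] := eventually_ge (2 * err R k * L ^+ 2 / ka).
have [N4 h4] := eventually_ge (L ^+ 2 / ka).
have [N5 h5] := eventually_ge (err R k * (1 + L ^+ 2) / (eps / 8 * ka)).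
exists D%:R^-1, (N1 + N2 + N3 + N4 + N5 + (K * s0) ^ 2 + 2 * K.+2)%N.
split=> [|n s nn ks sn]; first by rewrite invr_gt0 ltr0n.
have sD : (s * D <= 'C(n, K))%N.
  by move: sn; rewrite mulrC ler_pdivlMr ?ltr0n // -natrM ler_nat.
split; first by apply: leq_trans sD; rewrite leq_pmulr.
have le6 a b c d e f g m : (a + b + c + d + e + f + g <= m)%N ->
  [/\ (a <= m)%N, (b <= m)%N, (c <= m)%N & [/\ (d <= m)%N, (e <= m)%N, (f <= m)%N & (g <= m)%N]].
  by clear => h; split; last split; lia.
have [m1 m2 m3 [m4 m5 m6 m7]] := le6 _ _ _ _ _ _ _ _ nn.
have n2 : (n <= n.+2)%N by rewrite ltnW.
have [G [UG cG QP Q0]] := exists_family R n2 m6 ks sD.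
have n0 : (0 < n)%N by apply: leq_trans m7.
have n0R : 0 < n%:R :> R by rewrite ltr0n.
exists G; split=> //.
apply: (@pair_gap R k n _ G eps L) => //.
- by split=> A /colex_seg_layer[].
- by rewrite cG card_colex_seg.
- exact: h1.
- by rewrite [leRHS]mulrC -ler_pdivrMr ?exprn_gt0 //; apply: h2.
- by rewrite [leRHS]mulrC -ler_pdivrMr //; apply: h3.
- by rewrite [leRHS]mulrC -ler_pdivrMr //; apply: h4.
rewrite ler_pdivrMr // [leRHS]mulrC -ler_pdivrMr; first exact: h5.
by rewrite mulr_gt0 // divr_gt0.
Qed.

(** * The colex family *)

Local Close Scope ring_scope.

Section FsetImage.
Variables (U : finType) (Y : choiceType) (f : U -> Y).
Hypothesis f_inj : injective f.
Implicit Types X : {set U}.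

Definition fimg X : {fset Y} := [fset y in map f (enum X)]%fset.

Lemma fimgE X : perm_eq (fimg X) (map f (enum X)).
Proof.
apply: uniq_perm; rewrite ?fset_uniq ?map_inj_uniq ?enum_uniq // => y.
by rewrite !inE.
Qed.

Lemma fimgP X y : reflect (exists2 x, x \in X & y = f x) (y \in fimg X).
Proof.
rewrite (perm_mem (fimgE X)); apply: (iffP mapP) => [[x]|[x xX ->]].
  by rewrite mem_enum => xX ->; exists x.
by exists x; rewrite ?mem_enum.
Qed.

Lemma mem_fimg X x : (f x \in fimg X) = (x \in X).
Proof. by apply/fimgP/idP => [[y yX /f_inj ->]|xX] //; exists x. Qed.

Lemma card_fimg X : #|` fimg X|%fset = #|X|.
Proof. by rewrite (perm_size (fimgE X)) size_map -cardE. Qed.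

Lemma big_fimg (R : Type) (idx : R) (op : Monoid.com_law idx) X (F : Y -> R) :
  \big[op/idx]_(y <- fimg X) F y = \big[op/idx]_(x in X) F (f x).
Proof. by rewrite (perm_big _ (fimgE X)) big_map big_enum. Qed.

End FsetImage.

Section Embedding.
Variable N : nat.
Implicit Types A B : {set 'I_N}.

Definition emb A : {fset nat} := fimg (fun i : 'I_N => i.+1) A.

Let succ_inj : injective (fun i : 'I_N => i.+1).
Proof. by move=> i j [] /val_inj. Qed.

Lemma emb_inj : injective emb.
Proof.
move=> A B e; apply/setP => i.
by rewrite -(mem_fimg succ_inj A) -(mem_fimg succ_inj B) -/(emb A) e.
Qed.

Lemma card_emb A : #|` emb A|%fset = #|A|.
Proof. exact: card_fimg. Qed.

Lemma emb_gt0 A x : x \in emb A -> 0 < x.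
Proof. by move=> /(fimgP succ_inj)[i _ ->]. Qed.

Lemma colexval_emb A : colexval (emb A) = 2 * cv A.
Proof.
rewrite /colexval /emb big_fimg // /cv big_distrr /=.
by apply: eq_bigr => i _; rewrite expnS.
Qed.

Lemma wset_emb (R : realType) (w : nat -> R) A :
  wset w (emb A) = (\prod_(i in A) w i.+1)%R.
Proof. by rewrite /wset /emb big_fimg. Qed.

Lemma wgraph_emb (R : realType) (w : nat -> R) (H : {set {set 'I_N}}) :
  wgraph w (fimg emb H) = wsum H (fun i => w i.+1).
Proof.
rewrite /wgraph big_fimg; last exact: emb_inj.
by apply: eq_bigr => A _; rewrite wset_emb.
Qed.

Lemma emb_of_range (e : {fset nat}) : (forall x, x \in e -> 0 < x <= N) ->
  exists A, e = emb A.
Proof.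
move=> he; exists [set i : 'I_N | i.+1 \in e]; apply/fsetP => x.
apply/idP/(fimgP succ_inj) => [xe|[i]]; last by rewrite inE => ie ->.
have /andP[x0 xN] := he _ xe; have xN' : x.-1 < N by rewrite prednK.
by exists (Ordinal xN'); rewrite ?inE /= prednK.
Qed.

End Embedding.

Lemma mem_range1 n x : (x \in Defs.range1 n) = (0 < x <= n).
Proof. by rewrite in_fset /= mem_iota add1n ltnS. Qed.

Lemma colexval_ge (e : {fset nat}) x : x \in e -> 2 ^ x <= colexval e.
Proof.
by move=> xe; rewrite /colexval (big_fsetD1 x) //= leq_addr.
Qed.

Lemma leq_bigmax_fset (e : {fset nat}) x : x \in e -> x <= \max_(i <- e) i.
Proof. by move=> xe; rewrite (big_fsetD1 x) //= leq_maxl. Qed.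

Lemma colexval_lt (e : {fset nat}) m : (forall x, x \in e -> 0 < x <= m) ->
  colexval e < 2 ^ m.+1.
Proof.
move=> he; have [A ->] := emb_of_range he; rewrite colexval_emb expnS ltn_pmul2l //.
by apply: cv_lt; apply: sub_low.
Qed.

(** [colex_rank] only searches below the maximum of [e], but misses nothing: a vertex beyond that
    maximum alone outweighs [e]. *)
Lemma colex_rank_ge r (e : {fset nat}) (F : {fset {fset nat}}) :
  (forall x, x \in e -> 0 < x) ->
  (forall B, B \in F -> [/\ #|` B|%fset = r, forall x, x \in B -> 0 < x &
     colexval B < colexval e]) ->
  #|` F|%fset <= colex_rank r e.
Proof.
move=> e0 hF; rewrite /colex_rank -size_filter; apply: uniq_leq_size.
  exact: fset_uniq.
move=> B BF; have [cB B0 vB] := hF _ BF.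
rewrite mem_filter cB eqxx vB /= fpowersetE; apply/fsubsetP => x xB.
rewrite mem_range1 B0 //= leqNgt; apply/negP => mx.
have : colexval e < 2 ^ x.
  apply: leq_trans (_ : 2 ^ (\max_(i <- e) i).+1 <= _); last by rewrite leq_exp2l.
  by apply: colexval_lt => y ye; rewrite e0 // leq_bigmax_fset.
by rewrite ltnNge (leq_trans (colexval_ge xB) (ltnW vB)).
Qed.

Section ColexStructure.
Variables (n k s : nat).
Local Notation K := k.+2.
Local Notation t := n.+2.
Let m := 'C(n, k.+4) + 2 * 'C(n, k.+3) + s.
Hypothesis sn : s <= 'C(n, K).

Lemma colex_family_sub (e : {fset nat}) : e \in colex_family m k.+4 ->
  exists2 A, A \in pair_graph (vp n) (vq n) k (colex_seg n K s) & e = emb A.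
Proof.
rewrite !inE /= => /andP[eP /andP[/eqP ce re]].
have e0 x : x \in e -> 0 < x.
  move: eP; rewrite fpowersetE => /fsubsetP h /h.
  by rewrite mem_range1 => /andP[].
(* A vertex beyond [t] would put all ['C(t, k.+4) >= m] sets on [t] vertices before [e]. *)
have et x : x \in e -> 0 < x <= t.
  move=> xe; rewrite e0 //= leqNgt; apply/negP => tx.
  have := @colex_rank_ge k.+4 e (fimg (@emb t) (layer [set: 'I_t] k.+4)) e0.
  rewrite card_fimg; last exact: emb_inj.
  rewrite card_layer cardsT card_ord => h.
  have : 'C(t, k.+4) <= colex_rank k.+4 e.
    apply: h => B /(fimgP (@emb_inj _))[A].
    rewrite inE => /andP[_ /eqP cA] ->; split; rewrite ?card_emb //.
      by move=> y; apply: emb_gt0.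
    apply: leq_trans (colexval_ge xe); rewrite colexval_emb.
    apply: leq_trans (_ : 2 ^ t.+1 <= _); last by rewrite leq_exp2l.
    by rewrite expnS ltn_pmul2l // cv_lt // sub_low.
  rewrite leqNgt (leq_trans re) // bin_pascal2 /m leq_add2l //.
have [A eA] := emb_of_range et; exists A => //.
have cA : #|A| = k.+4 by rewrite -card_emb -eA.
rewrite inE cA eqxx /=; apply/implyP => /andP[pA qA].
pose B := A :\ vq n :\ vp n.
have pq := vp_neq_vq n.
have pA' : vp n \in A :\ vq n by rewrite !inE pA pq.
have cB : #|B| = K.
  have := cardsD1 (vq n) A; have := cardsD1 (vp n) (A :\ vq n).
  by rewrite qA pA' cA !add1n => -> [] <-.
have BV : B \subset low n.
  by rewrite -lowE /B; do 2 apply: setSD; apply: subsetT.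
rewrite inE; apply/andP; split; first by rewrite inE BV cB eqxx.
have vE : (vp n = n :> nat) * (vq n = n.+1 :> nat) by rewrite /= inordK.
have cvA : cv A = 2 ^ n.+1 + (2 ^ n + cv B).
  by rewrite (cvD1 qA) (cvD1 pA') !vE.
have UB : uniform_family ([set: 'I_t] :\ vq n :\ vp n) k (colex_before n K B).
  by rewrite lowE; split=> D; rewrite !inE => /andP[/andP[? /eqP ?] _].
(* The sets missing [vp] or [vq], and those whose remainder precedes [B], all precede [e]. Counting
   them bounds the rank of [B] by that of [e] minus the first two terms of [m]. *)
have := @colex_rank_ge k.+4 e (fimg (@emb t) (pair_graph (vp n) (vq n) k (colex_before n K B))) e0.
rewrite card_fimg; last exact: emb_inj.
rewrite card_pair_graph // card_ord subn2 /= => h.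
have {h} : 'C(n, k.+4) + 2 * 'C(n, k.+3) + #|colex_before n K B| < m.
  apply: leq_ltn_trans re; apply: h => D0 /(fimgP (@emb_inj _))[D].
  rewrite inE => /andP[/eqP cD hD] ->; split; rewrite ?card_emb //.
    by move=> y; apply: emb_gt0.
  rewrite eA !colexval_emb ltn_pmul2l //.
  have lowS (E : {set 'I_t}) : vq n \notin E -> E \subset low n.+1.
    move=> qE; apply/subsetP => i iE; rewrite inE; have := ltn_ord i; rewrite ltnS leq_eqVlt.
    case/orP => // /eqP ei; move: qE; rewrite (_ : vq n = i) ?iE //.
    by apply/val_inj; rewrite /= ei.
  have lowSS (E : {set 'I_t}) : vq n \notin E -> vp n \notin E -> E \subset low n.
    move=> qE pE; apply/subsetP => i iE.
    have := subsetP (lowS _ qE) _ iE; rewrite !inE ltnS leq_eqVlt.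
    case/orP => // /eqP ei; move: pE; rewrite (_ : vp n = i) ?iE //.
    by apply: ord_inj; rewrite vE ei.
  have [qD|qD] := boolP (vq n \in D); last first.
    by apply: leq_trans (cv_lt (lowS _ qD)) _; rewrite cvA leq_addr.
  rewrite cvA (cvD1 qD) vE ltn_add2l.
  have [pD|pD] := boolP (vp n \in D); last first.
    apply: leq_trans (_ : 2 ^ n <= _); last by rewrite leq_addr.
    by apply: cv_lt; apply: lowSS; rewrite !inE ?eqxx // (negPf pD) andbF.
  have pD' : vp n \in D :\ vq n by rewrite !inE pD pq.
  rewrite (cvD1 pD') vE ltn_add2l.
  by move: hD; rewrite qD pD /= inE => /andP[].
by rewrite /m ltn_add2l.
Qed.

Lemma wgraph_colex_le (R : realType) (w : nat -> R) : (forall x, 0 <= w x)%R ->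
  (wgraph w (colex_family m k.+4) <=
   wsum (pair_graph (vp n) (vq n) k (colex_seg n K s)) (fun i => w i.+1))%R.
Proof.
move=> w0; pose X := [set A : {set 'I_t} | emb A \in colex_family m k.+4].
have -> : colex_family m k.+4 = fimg (@emb t) X.
  apply/fsetP => e; apply/idP/(fimgP (@emb_inj _)) => [ec|[A]].
    by have [A _ eA] := colex_family_sub ec; exists A => //; rewrite in_set -eA.
  by rewrite in_set => ? ->.
rewrite wgraph_emb; apply: wsum_sub => //; apply/subsetP => A; rewrite in_set => eA.
by have [B BP /emb_inj ->] := colex_family_sub eA.
Qed.

Lemma pair_graph_rgraph (G : {set {set 'I_t}}) :
  is_rgraph k.+4 (fimg (@emb t) (pair_graph (vp n) (vq n) k G)).
Proof.
move=> e /(fimgP (@emb_inj _))[A]; rewrite inE => /andP[/eqP cA _] ->.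
by rewrite card_emb; split=> // x; apply: emb_gt0.
Qed.

Lemma card_pair_rgraph (G : {set {set 'I_t}}) : uniform_family (@low t n) k G ->
  #|G| = s -> #|` fimg (@emb t) (pair_graph (vp n) (vq n) k G)|%fset = m.
Proof.
move=> UG cG; rewrite card_fimg; last exact: emb_inj.
by rewrite card_pair_graph ?vp_neq_vq ?lowE // card_ord subn2 cG.
Qed.

End ColexStructure.

Local Open Scope ring_scope.

(** * Lagrangians *)

From mathcomp Require Import all_classical all_reals all_analysis.
Import numFieldNormedType.Exports.

Section Weightings.
Variable R : realType.

Lemma weighting_partial_sum (w : nat -> R) n : weighting w ->
  \sum_(0 <= j < n) w j <= 1.
Proof.
move=> [w0 [_ wcvg]].
have -> : 1 = limn (fun n : nat => \sum_(0 <= j < n) w j) by apply/esym/cvg_lim.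
apply: nondecreasing_cvgn_le; last by apply/cvg_ex; exists 1.
by apply: nondecreasing_series.
Qed.

Lemma weighting_prob (w : nat -> R) n : weighting w ->
  exists2 x : 'I_n.+1 -> R, prob x & forall i : 'I_n.+1, 0 <= w i.+1 <= x i.
Proof.
move=> ww; have [w0 [w00 _]] := ww.
have := weighting_partial_sum n.+2 ww.
rewrite big_mkord big_ord_recl w00 add0r => S1.
set S := \sum_(i < n.+1) _ in S1.
(* The mass lost by truncation goes to the first vertex; this only increases [wsum]. *)
exists (fun i : 'I_n.+1 => w i.+1 + (if i == ord0 then 1 - S else 0)).
  split=> [i|]; first by rewrite addr_ge0 //; case: ifP => //; rewrite subr_ge0.
  rewrite big_split /= -big_mkcond /= big_pred1_eq.
  rewrite (_ : \sum_(i < n.+1) w i.+1 = S); first by rewrite addrC subrK.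
  by apply: eq_bigr => i _.
by move=> i; rewrite w0 /= lerDl; case: ifP => //; rewrite subr_ge0.
Qed.

Lemma prob_weighting n (y : 'I_n -> R) : prob y ->
  exists2 w : nat -> R, weighting w & forall i : 'I_n, w i.+1 = y i.
Proof.
move=> [y0 sy].
pose v j : R := if insub j is Some i then y i else 0.
pose w j : R := if j is j'.+1 then v j' else 0.
have vE (i : 'I_n) : v i = y i by rewrite /v valK.
have v0 j : (n <= j)%N -> v j = 0 by move=> nj; rewrite /v insubF // ltnNge nj.
exists w => //; split; last split=> //.
  by case=> // j; rewrite /= /v; case: insubP.
apply: cvg_near_cst; near=> m.
have nm : (n.+1 <= m)%N by near: m; exact: nbhs_infty_ge.
rewrite -(subnKC nm) addSn big_mkord big_ord_recl add0r big_split_ord /=.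
rewrite [X in _ + X]big1 ?addr0; last by move=> i _; rewrite /= v0 // leq_addr.
by rewrite -[RHS]sy; apply: eq_bigr => i _; rewrite /= vE.
Unshelve. all: end_near. Qed.

Lemma prob_le1 (T : finType) (x : T -> R) i : prob x -> x i <= 1.
Proof. by move=> [x0 <-]; rewrite (bigD1 i) //= lerDl sumr_ge0. Qed.

Lemma lagrangian_emb_ge n (H : {set {set 'I_n.+1}}) (y : 'I_n.+1 -> R) : prob y ->
  wsum H y <= lagrangian R (fimg (@emb n.+1) H).
Proof.
move=> py; have [w ww wy] := prob_weighting py.
apply: ub_le_sup.
  (* The supremum needs an upper bound: every weight is at most 1. *)
  exists (wsum H (fun=> 1)) => _ [w' ww' <-]; rewrite wgraph_emb.
  have [x px xw] := weighting_prob n ww'.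
  apply: wsum_le => i; case/andP: (xw i) => -> wx.
  exact: le_trans wx (prob_le1 i px).
exists w => //; rewrite wgraph_emb; apply: eq_bigr => A _.
by apply: eq_bigr => i _; rewrite wy.
Qed.

End Weightings.

Theorem theorem1p3 (R : realType) (r : nat) (hr : (4 <= r)%N) :
  exists (alpha : R) (t0 : nat), 0 < alpha /\
    forall (t s : nat), (t0 <= t)%N ->
      (r <= s)%N -> (s%:R <= alpha * ('C(t - 2, r - 2))%:R) ->
      let m := ('C(t, r) - 'C(t - 2, r - 2) + s)%N in
      exists G : {fset {fset nat}},
        is_rgraph r G /\ #|` G|%fset = m /\
        lagrangian R (colex_family m r) < lagrangian R G.
Proof.
case: r hr => [|[|[|[|k]]]] // _.
have [alpha [n0 [alpha0 H]]] := exists_better R k.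
exists alpha, n0.+2; split=> // t s; case: t => [|[|n]] // nt ks.
rewrite !subn2 /= => hs.
have [sn [G [UG cG [gam gam0 hG]]]] := H n s nt ks hs.
rewrite bin_pascal2 addnK; set G' := pair_graph _ _ _ G in hG.
exists (fimg (@emb n.+2) G'); split; first exact: pair_graph_rgraph.
split; first exact: card_pair_rgraph.
(* Bounding the supremum by a value lower by [gam] is what makes the inequality strict. *)
apply: (@le_lt_trans _ _ (lagrangian R (fimg (@emb n.+2) G') - gam)); last first.
  by rewrite ltrBlDr ltrDl.
apply: ge_sup.
  have u : prob (fun i : 'I_n.+2 => n.+2%:R^-1 : R).
    split=> [i|]; first by rewrite invr_ge0.
    by rewrite sumr_const card_ord -[LHS]mulr_natr mulVf // pnatr_eq0.
  have [w ww _] := prob_weighting u; by eexists; exists w.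
move=> _ [w ww <-]; have [w0 _] := ww.
have [x px xw] := weighting_prob n.+1 ww.
have [y py hy] := hG x px.
rewrite lerBrDr; apply: le_trans (lagrangian_emb_ge G' py).
apply: le_trans hy; rewrite lerD2r.
apply: le_trans (wgraph_colex_le _ w0) _ => //.
exact: wsum_le.
Qed.
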